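(* For every integer $n \ge 5$, $ex_{_\mathcal{P}}(n,\Theta_5)\leq \frac{5(n-2)}{2}$. Moreover, equality $ex_{_\mathcal{P}}(n,\Theta_5)= \frac{5(n-2)}{2}$ holds for every such $n$ with $n\equiv 50 \pmod{120}$.
   Context: All graphs are finite and simple. For a family $\mathcal{F}$ of graphs, a graph is $\mathcal{F}$-free if it contains no graph in $\mathcal{F}$ as a (not necessarily induced) subgraph. The planar Turán number $ex_{_\mathcal{P}}(n,\mathcal{F})$ is the maximum number of edges in an $\mathcal{F}$-free planar graph on $n$ vertices; when $\mathcal{F}=\{F\}$ one writes $ex_{_\mathcal{P}}(n,F)$. A Theta graph is a graph on at least $4$ vertices obtained from a cycle by adding one additional edge joining two non-consecutive vertices of the cycle. For an integer $k\ge 4$, $\Theta_k$ denotes the family of all non-isomorphic Theta graphs on $k$ vertices. The family $\Theta_5$ consists of a single graph (the $5$-cycle plus one chord), which is also denoted $\Theta_5$. *)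

(* Defs.v *)
From HB Require Import structures.
From mathcomp Require Import all_boot all_order all_algebra.
From mathcomp Require Import boolp reals.

Set Implicit Arguments.
Unset Strict Implicit.
Unset Printing Implicit Defensive.

Import Order.TTheory GRing.Theory Num.Theory.
Local Open Scope ring_scope.

(* An edge is the two-element set of its endpoints. *)
Record sgraph (V : finType) := SGraph {
  edges : {set {set V}};
  edgesP : [forall e in edges, #|e| == 2%N] }.

HB.instance Definition _ (V : finType) := [isSub for @edges V].
HB.instance Definition _ (V : finType) := [Finite of sgraph V by <:].

(* Not necessarily induced. *)
Definition is_subgraph (U V : finType) (H : sgraph U) (G : sgraph V) : Prop :=
  exists f : U -> V,
    injective f /\ forall e, e \in edges H -> f @: e \in edges G.

(* Every finite graph is isomorphic to one with vertex set 'I_m for some m. *)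
Definition graph_family := forall m : nat, sgraph 'I_m -> Prop.

Definition family_free (F : graph_family) (V : finType) (G : sgraph V) : Prop :=
  forall (m : nat) (H : sgraph 'I_m), F m H -> ~ is_subgraph H G.

Definition cycle_edges (k : nat) : {set {set 'I_k}} :=
  [set [set i; ordS i] | i : 'I_k].

(* Labelled representatives: each isomorphism type of Theta graph on k
   vertices occurs, possibly several times. Chords exist only if k >= 4. *)
Definition Theta (k : nat) : graph_family := fun m H =>
  m = k /\
  exists i j : 'I_m,
    [/\ i != j, [set i; j] \notin cycle_edges m &
        edges H = [set i; j] |: cycle_edges m].

Section PlaneDrawings.
Variable R : realType.

Notation point := 'rV[R]_2.

Definition on_segment (a b x : point) : Prop :=
  exists t : R, 0 <= t <= 1 /\ x = (1 - t) *: a + t *: b.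

(* The polygonal curve visiting a, then the points of s in order. *)
Fixpoint on_polyline (a : point) (s : seq point) (x : point) : Prop :=
  if s is b :: s' then on_segment a b x \/ on_polyline b s' x else x = a.

(* The curve does not meet itself: it is homeomorphic to [0, 1] or a point. *)
Fixpoint simple_polyline (a : point) (s : seq point) : Prop :=
  if s is b :: s' then
    [/\ a != b,
        forall x, on_segment a b x -> on_polyline b s' x -> x = b &
        simple_polyline b s']
  else True.

(* A drawing without crossings, with edges drawn as simple polygonal arcs
   (as in the textbooks of Diestel and West). The curve of an edge e is
   polyline (arc e).1 (arc e).2, traversed in an arbitrary direction. *)
Record plane_drawing (V : finType) (G : sgraph V)
    (pos : V -> point) (arc : {set V} -> point * seq point) : Prop := {
  pos_inj : injective pos;
  arc_simple : forall e, e \in edges G -> simple_polyline (arc e).1 (arc e).2;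
  arc_ends : forall e, e \in edges G ->
    exists u v : V, [/\ e = [set u; v], (arc e).1 = pos u &
                        last (arc e).1 (arc e).2 = pos v];
  arc_vertex : forall e w, e \in edges G ->
    on_polyline (arc e).1 (arc e).2 (pos w) -> w \in e;
  arc_disjoint : forall e f, e \in edges G -> f \in edges G -> e != f ->
    forall x, on_polyline (arc e).1 (arc e).2 x ->
              on_polyline (arc f).1 (arc f).2 x ->
              exists2 w, w \in e :&: f & x = pos w }.

Definition planar (V : finType) (G : sgraph V) : Prop :=
  exists pos arc, @plane_drawing V G pos arc.

(* The edgeless graph is planar, so for families without edgeless members this
   is a maximum over a nonempty set. *)
Definition exP (n : nat) (F : graph_family) : nat :=
  \max_(G : sgraph 'I_n | `[< planar G /\ family_free F G >]) #|edges G|.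

End PlaneDrawings.

(* Main.v *)
(* Upper bound. Sweep the drawing by a vertical line in a generic direction and
   attach to every gap between consecutive segments on the line the functional
   on the even edge sets of G counting, modulo 2, the edges below the gap. This
   value does not change while sweeping past a vertex, so it labels the face
   containing the gap. The labels span the dual of the cycle space and 0 is one
   of them, hence there are at least |E| - n + 2 labels; the set of edges with
   exactly one side labelled p is an even edge set, and the dual graph is
   connected. Discharging these even edge sets (a triangular face sharing two
   edges with triangular faces spans a K4, whose outer edge lies on a face of
   length at least 5) gives 5 |F| <= 3 |E|.

   Lower bound. Tightness forces every face to be a pentagon or a triangle
   inside a K4. Half of the icosidodecahedron, cut along two meridians from a
   vertex N to its antipode S, is repeated q times around N and S, and every
   triangle gets a new vertex joined to its corners: 24 q + 2 vertices and 60 q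
   edges. All 4-cycles lie inside these K4, so there is no Theta_5. For
   n = 50 mod 120 one has q = 2 mod 5, so q = 2 (the icosidodecahedron) or
   q >= 7, where a Theta_5 would lift to the universal cover of the band between
   N and S and can be excluded by a finite search. *)
Require Import Defs.
From mathcomp Require Import all_boot all_order all_algebra zify ring lra.
From mathcomp Require Import boolp reals.

Set Implicit Arguments.
Unset Strict Implicit.
Unset Printing Implicit Defensive.

Import Order.TTheory GRing.Theory Num.Theory.
Local Open Scope ring_scope.

(** * Triangular faces in a graph without Theta_5 *)

(** Planarity is given by arcs without any notion of face, and the usual passage from one to the
    other is the Jordan curve theorem. Labels avoid it: they are computed on the sweep line alone,
    and their number is at least what Euler's formula predicts, which is the direction that an upper
    bound on edges uses. From [|E| + 2 <= n + |F|] and [5 |F| <= 3 |E|] follows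
    [2 |E| <= 5 (n - 2)]. The graph may be disconnected or have bridges, so a face boundary is
    treated as an even edge set and not as a cycle; sets of three or four edges are nevertheless
    genuine cycles, and discharging looks inside no others. Connectivity of the dual enters because
    a plane K4 alone has four triangular faces: as soon as there is a fifth label, four triangles
    cannot close up. In the construction each wedge brings 24 vertices and 60 edges, the extremal
    ratio 5/2, and the two poles account for the 2 in [n - 2]. The sweep is used there in the
    opposite direction: a combinatorial sweep is turned into a drawing. *)

Definition no_theta5 (V : finType) (E : {set {set V}}) : Prop :=
  forall x0 x1 x2 x3 x4 : V, uniq [:: x0; x1; x2; x3; x4] ->
    [set x0; x1] \in E -> [set x1; x2] \in E -> [set x2; x3] \in E ->
    [set x3; x4] \in E -> [set x4; x0] \in E -> [set x0; x2] \in E -> False.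

Lemma theta_free_no_theta5 (V : finType) (G : sgraph V) :
  family_free (Theta 5) G -> no_theta5 (edges G).
Proof.
move=> free x0 x1 x2 x3 x4 xU e01 e12 e23 e34 e40 e02.
pose i0 : 'I_5 := inord 0; pose i2 : 'I_5 := inord 2.
have cyc : forall i : 'I_5, [set i; ordS i] \in cycle_edges 5.
  by move=> i; apply/imsetP; exists i.
have neS (i : 'I_5) : i != ordS i.
  by case: i => -[|[|[|[|[|//]]]]] ?.
have HP : [forall e in [set i0; i2] |: cycle_edges 5, #|e| == 2%N].
  apply/forall_inP => e /setU1P[->|/imsetP[i _ ->]]; rewrite cards2 ?neS //.
  by rewrite -val_eqE /= !inordK.
pose H := SGraph HP.
apply: (free 5%N H).
  split=> //; exists i0, i2; split => //.
    by rewrite -val_eqE /= !inordK.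
  apply/imsetP => -[i _ /setP eqi].
  have := eqi i0; have := eqi i2; rewrite !inE !eqxx !orbT.
  rewrite -!val_eqE /= !inordK //; case: i {eqi} => -[|[|[|[|[|//]]]]] ? //=.
pose t : 5.-tuple V := [tuple x0; x1; x2; x3; x4].
exists (tnth t); split; first by apply/injectiveP;
  rewrite /injectiveb /dinjectiveb map_tnth_enum.
move=> e /setU1P[->|/imsetP[i _ ->]]; rewrite imsetU !imset_set1 !(tnth_nth x0).
  by rewrite /= !inordK.
by case: i => -[|[|[|[|[|//]]]]] ?.
Qed.

(** * Even edge sets with three or four edges *)

Definition even_edges (V : finType) (B : {set {set V}}) : bool :=
  [forall v, ~~ odd #|[set e in B | v \in e]|].

Lemma doubleton_eqP (T : finType) (a b c d : T) :
  reflect ((a = c /\ b = d) \/ (a = d /\ b = c)) ([set a; b] == [set c; d]).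
Proof.
apply: (iffP eqP) => [/setP eq|[[-> ->]|[-> ->]]] //; last by rewrite setUC.
have := eq a; have := eq b; have := eq c; have := eq d.
rewrite !inE !eqxx !orbT /= [d == a]eq_sym [d == b]eq_sym [c == a]eq_sym [c == b]eq_sym.
case: (eqVneq a c) => [?|_]; case: (eqVneq a d) => [?|_]; case: (eqVneq b c) => [?|_];
  by case: (eqVneq b d) => [?|_] /=; intuition congruence.
Qed.

Section EvenSets.
Variables (V : finType) (B : {set {set V}}).
Hypotheses (pairB : forall e, e \in B -> #|e| = 2%N) (evB : even_edges B).

Lemma even_edges_next a b : [set a; b] \in B ->
  exists c, [/\ c != b, c != a & [set a; c] \in B].
Proof.
move=> abB; have /forallP/(_ a) := evB.
have abS : [set a; b] \in [set e in B | a \in e] by rewrite !inE abB eqxx.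
rewrite (cardsD1 [set a; b]) abS /= negbK => /odd_gt0.
case/card_gt0P=> e; rewrite !inE => /and3P[neq eB ae].
have /eqP/cards2P[x [y [nxy ex]]] := pairB eB.
have [c ec] : exists c, e = [set a; c].
  by move: ae; rewrite ex !inE => /orP[/eqP->|/eqP->]; [exists y | exists x;
    rewrite setUC].
exists c; split; last by rewrite -ec.
  by apply: contraNneq neq => <-; rewrite ec.
by move: (pairB eB); rewrite ec cards2 eq_sym; case: eqP.
Qed.

Lemma pair_neq a b : [set a; b] \in B -> a != b.
Proof. by move/pairB; rewrite cards2; case: eqP. Qed.

(** Even degree at both ends prolongs the edge [ab] on both sides. The ends [c] and [d] may
    coincide, and then the three edges form a triangle. *)
Lemma even_edges_path a b : [set a; b] \in B ->
  exists c d, [/\ [set a; c] \in B, [set b; d] \in B,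
   (c != b) && (c != a), (d != a) && (d != b) &
   uniq [:: [set a; b]; [set a; c]; [set b; d]]].
Proof.
move=> abB; have [c [ncb nca acB]] := even_edges_next abB.
have [|d [nda ndb bdB]] := @even_edges_next b a; first by rewrite setUC.
have nab := pair_neq abB.
exists c, d; split=> //; rewrite ?ncb ?nca ?nda ?ndb //=.
rewrite !inE !negb_or !andbT -!andbA; apply/and3P; split; apply/doubleton_eqP;
  move=> [[? ?]|[? ?]]; subst; rewrite ?eqxx // in nab ncb nca nda ndb.
Qed.

Lemma even_edges_ge3 : B != set0 -> (3 <= #|B|)%N.
Proof.
case/set0Pn=> e eB; have /eqP/cards2P[a [b [nab ex]]] := pairB eB.
rewrite ex in eB; have [c [d [acB bdB _ _ U]]] := even_edges_path eB.
apply: (@leq_trans (size [:: [set a; b]; [set a; c]; [set b; d]])) => //.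
rewrite cardE; apply: uniq_leq_size => // x; rewrite !inE mem_enum => /or3P[] /eqP -> //.
Qed.

Lemma sub_seq_eq (s : seq {set V}) : uniq s -> {subset s <= B} ->
  (#|B| <= size s)%N -> B =i s.
Proof.
move=> sU sB Bs x; have [//|//|_ ->] := uniq_min_size sU (s2 := enum B) _ _.
- by move=> y /sB; rewrite mem_enum.
- by rewrite -cardE.
- by rewrite mem_enum.
Qed.

Lemma even_edges3 a b : #|B| = 3 -> [set a; b] \in B ->
  exists c, [/\ a != b, c != a, c != b & B =i [:: [set a; b]; [set b; c]; [set a; c]]].
Proof.
move=> B3 abB; have nab := pair_neq abB.
have [c [d [acB bdB /andP[ncb nca] /andP[nda ndb] U]]] := even_edges_path abB.
have BE : B =i [:: [set a; b]; [set a; c]; [set b; d]].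
  apply: sub_seq_eq => //; last by rewrite B3.
  by move=> x; rewrite !inE => /or3P[] /eqP ->.
have [|x [nxa nxc]] := @even_edges_next c a; first by rewrite setUC.
rewrite BE !inE => /or3P[] /doubleton_eqP[[? ?]|[? ?]]; subst;
  rewrite ?eqxx // in nca ncb nxa *.
exists d; split=> // y; rewrite BE !inE; congr orb; exact: orbC.
Qed.

Lemma even_edges4 a b : #|B| = 4 -> [set a; b] \in B ->
  exists x y, [/\ uniq [:: a; b; x; y], [set b; x] \in B, [set x; y] \in B &
               [set y; a] \in B].
Proof.
move=> B4 abB; have nab := pair_neq abB.
have [c [d [acB bdB /andP[ncb nca] /andP[nda ndb] U]]] := even_edges_path abB.
have [e eB en] : exists2 e, e \in B & e \notin [:: [set a; b]; [set a; c]; [set b; d]].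
  have /allPn[e] : ~~ all (mem [:: [set a; b]; [set a; c]; [set b; d]]) (enum B).
    apply/allP => sub; have := uniq_leq_size (enum_uniq _) sub.
    by rewrite -cardE B4.
  by rewrite mem_enum => ? ?; exists e.
have BE : B =i [:: e; [set a; b]; [set a; c]; [set b; d]].
  apply: sub_seq_eq; first by rewrite cons_uniq en U.
    by move=> x; rewrite !(in_cons, in_nil) => /or4P[/eqP->|/eqP->|/eqP->|/orP[/eqP->|]].
  by rewrite B4.
have nxt z : z != a -> z != b -> forall w, [set z; w] \in B ->
    exists x, [/\ x != w, x != z, [set z; x] \in B &
     [|| [set z; x] == e, [set z; x] == [set a; c] | [set z; x] == [set b; d]]].
  move=> nza nzb w /even_edges_next [x [nxw nxz zxB]]; exists x; split=> //.
  move: zxB; rewrite BE !inE => /or4P[->|/doubleton_eqP|->|->]; rewrite ?orbT //.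
  by case=> -[? _]; subst; rewrite eqxx in nza nzb.
have [x [nxa nxc cxB]] : exists x, [/\ x != a, x != c, [set c; x] \in B &
     [|| [set c; x] == e, [set c; x] == [set a; c] | [set c; x] == [set b; d]]].
  by apply: nxt => //; rewrite setUC.
have [y [nyb nyd dyB]] : exists y, [/\ y != b, y != d, [set d; y] \in B &
     [|| [set d; y] == e, [set d; y] == [set a; c] | [set d; y] == [set b; d]]].
  by apply: nxt => //; rewrite setUC.
have [dc|ndc] := eqVneq d c.
  (* Now [a], [b], [c] carry a triangle. Even degree forces both ends of the fourth edge [e] to be
     corners of it, so [e] would repeat a side. *)
  subst d; have /eqP/cards2P[p [q [npq ex]]] := pairB eB.
  have key p' q' : e = [set p'; q'] -> p' \in [:: a; b; c].
    move=> ex'; have [|r [nrq nrp]] := @even_edges_next p' q'; first by rewrite -ex'.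
    rewrite BE !inE ex' => /or4P[] /doubleton_eqP[] [? ?]; subst;
      rewrite ?eqxx ?orbT // in nrq *.
  have := key p q ex; have := key q p; rewrite setUC => /(_ ex).
  move: en; rewrite ex !inE !negb_or => /and3P[n1 n2 n3].
  move: n1 n2 n3; rewrite -(setUC [set q]) => m1 m2 m3; move: m1 m2 m3 (m1) (m2) (m3).
  rewrite {4 5 6}(setUC [set q]) => n1 n2 n3 m1 m2 m3.
  by case/or3P=> /eqP ? /or3P[] /eqP ?; subst; rewrite ?eqxx // in npq n1 n2 n3 m1 m2 m3.
have eqc (z w p q : V) : [set z; w] = [set p; q] -> (z = p /\ w = q) \/ (z = q /\ w = p).
  by move/eqP/doubleton_eqP.
case/or3P=> /eqP dye; last 2 first.
- by case: (eqc _ _ _ _ dye) => -[? ?]; subst; rewrite eqxx in nda ndc.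
- by case: (eqc _ _ _ _ dye) => -[? ?]; subst; rewrite eqxx in nyb ndb.
case/or3P=> /eqP cxe; last 2 first.
- by case: (eqc _ _ _ _ cxe) => -[? ?]; subst; rewrite eqxx in nxa nca.
- by case: (eqc _ _ _ _ cxe) => -[? ?]; subst; rewrite eqxx in ncb ndc.
move: cxe; rewrite -dye => /eqc [[? _]|[cy _]]; first by subst; rewrite eqxx in ndc.
exists d, c; split=> //; last by rewrite setUC.
  rewrite /= !inE !negb_or nab ndc eq_sym nda eq_sym nca eq_sym ndb eq_sym ncb //.
by rewrite cy.
Qed.

End EvenSets.

(** * Discharging between faces and edges *)

Section Discharging.
Local Open Scope nat_scope.
Variables (V W : finType) (E : {set {set V}}) (P : {set W}).
Variable B : W -> {set {set V}}.
Hypothesis pairE : forall e, e \in E -> #|e| = 2.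
Hypothesis subE : forall p, p \in P -> B p \subset E.
Hypothesis evB : forall p, p \in P -> even_edges (B p).
Hypothesis two : forall e p, p \in P -> e \in B p ->
  #|[set q in P | e \in B q]| = 2.
(** Four is the number of triangles in a K4, the largest set to which this is applied. For a plane
    graph the hypothesis holds once there are at least five labels. *)
Hypothesis indep : forall S : {set W}, S \subset P -> S != set0 -> #|S| <= 4 ->
  exists e, odd #|[set q in S | e \in B q]|.
Hypothesis no_theta : no_theta5 E.

Lemma pairB p e : p \in P -> e \in B p -> #|e| = 2.
Proof. by move=> pP eB; apply: pairE; apply: (subsetP (subE pP)). Qed.

Lemma inE_B p e : p \in P -> e \in B p -> e \in E.
Proof. by move=> pP eB; apply: (subsetP (subE pP)). Qed.

Lemma face_ge3 p : p \in P -> 3 <= #|B p|.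
Proof.
move=> pP; apply: even_edges_ge3 (evB pP) _; first by move=> e; apply: pairB.
have [|||e oe] := indep (S := [set p]); rewrite ?sub1set ?cards1 //.
  by apply/set0Pn; exists p; rewrite set11.
apply/set0Pn; exists e; apply: contraLR oe => neB.
rewrite (_ : [set _ in _ | _] = set0) ?cards0 //.
by apply/setP=> q; rewrite !inE; case: eqP => [->|//]; rewrite (negbTE neB).
Qed.

Lemma face_two e p q r : p \in P -> q \in P -> r \in P -> p != q ->
  e \in B p -> e \in B q -> e \in B r -> (r == p) || (r == q).
Proof.
move=> pP qP rP npq ep eq er; rewrite -in_set2.
suff -> : [set p; q] = [set q in P | e \in B q] by rewrite inE rP.
apply/eqP; rewrite eqEcard (two pP ep) cards2 npq leqnn andbT.
by apply/subsetP => x; rewrite !inE => /orP[] /eqP ->; apply/andP.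
Qed.

Lemma face_other e p : p \in P -> e \in B p ->
  exists q, [/\ q \in P, q != p & e \in B q].
Proof.
move=> pP ep; have /eqP := two pP ep; rewrite (cardsD1 p) inE pP ep.
rewrite eqSS => /eqP H; have /card_gt0P[q] : 0 < #|[set q in P | e \in B q] :\ p| by
  rewrite H.
by rewrite !inE => /and3P[? ? ?]; exists q.
Qed.

Lemma face_inj p q : p \in P -> q \in P -> B p =i B q -> p = q.
Proof.
move=> pP qP eqB; apply/eqP; apply: contraT => npq.
have [|||e] := indep (S := [set p; q]).
- by apply/subsetP => x; rewrite !inE => /orP[] /eqP ->.
- by apply/set0Pn; exists p; rewrite set21.
- by rewrite cards2 npq.
case eB: (e \in B p).
  rewrite (_ : [set _ in _ | _] = [set p; q]) ?cards2 ?npq //.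
  by apply/setP=> r; rewrite !inE; case: eqP => [->|_] /=; [|case: eqP => [->|//]];
    rewrite -?eqB eB.
rewrite (_ : [set _ in _ | _] = set0) ?cards0 //.
by apply/setP=> r; rewrite !inE; case: eqP => [->|_] /=; [|case: eqP => [->|//]];
  rewrite -?eqB eB.
Qed.

Let P3 := [set p in P | #|B p| == 3].
Let P4 := [set p in P | #|B p| == 4].
Let P5 := [set p in P | 5 <= #|B p|].
Let t e := #|[set q in P3 | e \in B q]|.
Let shared := [set e | t e == 2].
Let m p := #|[set e in B p | e \in shared]|.

Lemma P3P p : p \in P3 -> p \in P /\ #|B p| = 3.
Proof. by rewrite inE => /andP[-> /eqP]. Qed.

Lemma t_le2 e : t e <= 2.
Proof.
rewrite /t; have [->|/set0Pn[p]] := eqVneq [set q in P3 | e \in B q] set0.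
  by rewrite cards0.
rewrite inE => /andP[/P3P[pP _] ep]; rewrite -(two pP ep); apply: subset_leq_card.
by apply/subsetP => q; rewrite !inE => /andP[/andP[-> _] ->].
Qed.

Lemma sharedP e p : p \in P3 -> e \in B p ->
  reflect (exists q, [/\ q \in P3, q != p & e \in B q]) (e \in shared).
Proof.
move=> p3 ep; rewrite inE /t (cardsD1 p) inE p3 ep /= eqSS.
apply: (iffP idP) => [/eqP H|[q [q3 nqp eq]]].
  have /card_gt0P[q] : 0 < #|[set q in P3 | e \in B q] :\ p| by rewrite H.
  by rewrite !inE => /and3P[? ? ?]; exists q; rewrite inE.
have := t_le2 e; rewrite /t (cardsD1 p) inE p3 ep /= add1n ltnS => le1.
rewrite eqn_leq le1 /=; apply/card_gt0P; exists q; rewrite in_setD1 nqp inE q3 //.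
Qed.

Lemma face3 p a b : p \in P3 -> [set a; b] \in B p ->
  exists c, [/\ a != b, c != a, c != b & B p =i [:: [set a; b]; [set b; c]; [set a; c]]].
Proof.
by move=> /P3P[pP B3]; apply: (even_edges3 _ (evB pP) B3) => e; apply: pairB.
Qed.

Lemma apex p q a b c : p \in P3 -> q \in P3 -> p != q ->
  B p =i [:: [set a; b]; [set b; c]; [set a; c]] -> [set a; b] \in B q ->
  exists x, [/\ x != a, x != b, x != c & B q =i [:: [set a; b]; [set b; x]; [set a; x]]].
Proof.
move=> p3 q3 npq Bp abq; have [x [nab nxa nxb Bq]] := face3 q3 abq.
exists x; split=> //; apply: contraNneq npq => exc; apply/eqP; apply: face_inj.
- by case: (P3P p3).
- by case: (P3P q3).
- by move=> e; rewrite Bp Bq exc.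
Qed.

(* If two edges of a triangular face lie on further triangular faces with
   different apices, the three triangles contain a 5-cycle with a chord. *)
Lemma common_apex p q1 q2 a b c : p \in P3 -> q1 \in P3 -> q2 \in P3 ->
  p != q1 -> p != q2 -> B p =i [:: [set a; b]; [set b; c]; [set a; c]] ->
  [set b; c] \in B q1 -> [set a; c] \in B q2 ->
  exists d, [/\ d != a, d != b, d != c,
    B q1 =i [:: [set b; c]; [set c; d]; [set b; d]] &
    B q2 =i [:: [set a; c]; [set c; d]; [set a; d]]].
Proof.
move=> p3 q13 q23 np1 np2 Bp bc1 ac2.
have [|d [ndb ndc nda B1]] := @apex p q1 b c a p3 q13 np1 _ bc1.
  move=> e; rewrite Bp !inE (setUC [set c] [set a]) (setUC [set b] [set a]).
  by case: (e == [set a; b]); case: (e == [set b; c]); case: (e == [set a; c]).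
have [|x [nxa nxc nxb B2]] := @apex p q2 a c b p3 q23 np2 _ ac2.
  move=> e; rewrite Bp !inE (setUC [set c] [set b]).
  by case: (e == [set a; b]); case: (e == [set b; c]); case: (e == [set a; c]).
exists d; split=> //; have [dx|ndx] := eqVneq d x; first by rewrite dx.
have abp : [set a; b] \in B p by rewrite Bp !inE eqxx.
have [_ [nab _ _ _]] := face3 p3 abp.
have bcp : [set b; c] \in B p by rewrite Bp !inE eqxx ?orbT.
have [_ [nbc _ _ _]] := face3 p3 bcp.
have acp : [set a; c] \in B p by rewrite Bp !inE eqxx ?orbT.
have [_ [nac _ _ _]] := face3 p3 acp.
have [[[pP _] [q1P _]] [q2P _]] := (P3P p3, P3P q13, P3P q23).
case: (no_theta (x0 := b) (x1 := d) (x2 := c) (x3 := x) (x4 := a)).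
- rewrite /= !inE !negb_or ![b == _]eq_sym ndb nab nxb eq_sym nbc ndc ndx nda /=.
  by rewrite eq_sym nxc eq_sym nac nxa.
- by apply: (inE_B q1P); rewrite B1 !inE eqxx ?orbT.
- by apply: (inE_B q1P); rewrite B1 !inE setUC eqxx ?orbT.
- by apply: (inE_B q2P); rewrite B2 !inE eqxx ?orbT.
- by apply: (inE_B q2P); rewrite B2 !inE setUC eqxx ?orbT.
- exact: inE_B abp.
- exact: inE_B bcp.
Qed.

(** If all three sides of [p] were shared, applying [common_apex] to two pairs of sides would give
    the three neighbouring triangles one apex [d]. The four triangles of this K4 cover every edge
    zero or two times, against [indep]. *)
Lemma m_le2 p : p \in P3 -> m p <= 2.
Proof.
move=> p3; rewrite leqNgt; apply/negP => m3; have [pP B3] := P3P p3.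
have sh e : e \in B p -> exists q, [/\ q \in P3, q != p & e \in B q].
  move=> ep; apply/(sharedP p3 ep); apply: contraLR m3 => nsh; rewrite -leqNgt.
  rewrite -ltnS -B3 /m; apply: proper_card; apply/properP; split.
    by apply/subsetP => x; rewrite inE => /andP[].
  by exists e; rewrite // inE ep.
have [e ep] : exists e, e \in B p by apply/card_gt0P; rewrite B3.
have /eqP/cards2P[a [b [nab ex]]] := pairB pP ep; rewrite ex in ep; clear e ex.
have [c [_ nca ncb Bp]] := face3 p3 ep.
have [q3 [q33 nq3 ab3]] := sh _ ep.
have [|q1 [q13 nq1 bc1]] := sh [set b; c]; first by rewrite Bp !inE eqxx orbT.
have [|q2 [q23 nq2 ac2]] := sh [set a; c]; first by rewrite Bp !inE eqxx !orbT.
have [||d [nda ndb ndc B1 B2]] := common_apex p3 q13 q23 _ _ Bp bc1 ac2;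
  rewrite 1?eq_sym //.
have [|||||x [nxc nxa nxb B3' B1']] := @common_apex p q3 q1 c a b p3 q33 q13.
- by rewrite eq_sym.
- by rewrite eq_sym.
- move=> e'; rewrite Bp !inE (setUC [set c] [set a]) (setUC [set c] [set b]).
  by case: (e' == [set a; b]); case: (e' == [set b; c]); case: (e' == [set a; c]).
- exact: ab3.
- by rewrite setUC.
have {B1'} xd : x = d.
  have : [set b; x] \in B q1 by rewrite B1' !inE eqxx orbT.
  by rewrite B1 !inE => /or3P[] /doubleton_eqP[[? ?]|[? ?]] //; subst;
    rewrite ?eqxx // in nxa nxb nxc nab nca ncb nda ndb ndc.
rewrite xd in B3'; clear x xd nxa nxb nxc.
pose S := [set p; q1; q2; q3].
have SP : S \subset P.
  by apply/subsetP => r; rewrite !inE => /orP[/orP[/orP[]|]|] /eqP -> //;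
     [case: (P3P q13) | case: (P3P q23) | case: (P3P q33)].
have S4 : #|S| <= 4.
  rewrite /S -!setUA; apply: leq_trans (leq_card_setU _ _) _; rewrite cards1 add1n ltnS.
  apply: leq_trans (leq_card_setU _ _) _; rewrite cards1 add1n ltnS.
  by rewrite cards2; case: (_ != _).
have [|e] := indep SP _ S4; first by apply/set0Pn; exists p; rewrite !inE eqxx.
suff : #|[set q in S | e \in B q]| = 0 \/ #|[set q in S | e \in B q]| = 2 by case=> ->.
have pair2 r s : r \in S -> s \in S -> r != s -> e \in B r -> e \in B s ->
    #|[set q in S | e \in B q]| = 2.
  move=> rS sS nrs er es; have rP := subsetP SP _ rS.
  apply/eqP; rewrite eqn_leq -{1}(two rP er); apply/andP; split.
    apply: subset_leq_card; apply/subsetP => x; rewrite !(inE, in_set) => /andP[xS ->].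
    by rewrite (subsetP SP) ?inE.
  rewrite (_ : 2 = #|[set r; s]|); last by rewrite cards2 nrs.
  apply: subset_leq_card; apply/subsetP => x; rewrite !inE => /orP[] /eqP ->.
    by rewrite er andbT; move: rS; rewrite !inE.
  by rewrite es andbT; move: sS; rewrite !inE.
have [pS q1S q2S q3S] : [/\ p \in S, q1 \in S, q2 \in S & q3 \in S].
  by rewrite !inE !eqxx ?orbT.
have ne12 : q1 != q2.
  apply: contraTneq ac2 => <-; rewrite B1 !inE;
    apply/negP => /or3P[] /doubleton_eqP[] [? ?];
  by subst; rewrite ?eqxx // in nda nab nca.
have ne13 : q1 != q3.
  apply: contraTneq ab3 => <-; rewrite B1 !inE;
    apply/negP => /or3P[] /doubleton_eqP[] [? ?];
  by subst; rewrite ?eqxx // in nda nab nca.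
have ne23 : q2 != q3.
  apply: contraTneq ab3 => <-; rewrite B2 !inE;
    apply/negP => /or3P[] /doubleton_eqP[] [? ?];
  by subst; rewrite ?eqxx // in ndb nab ncb.
have [/pred0Pn[q]|/negbNE] := boolP (~~ pred0b [pred q in S | e \in B q]); last first.
  move=> /eqP H; left; rewrite -H; apply: eq_card => q; rewrite !inE //.
move=> /= /andP[qS eq]; right.
have : [|| e == [set a; b], e == [set b; c], e == [set a; c], e == [set c; d],
   e == [set a; d] | e == [set b; d]].
  move: eq; move: qS; rewrite !inE => /orP[/orP[/orP[]|]|] /eqP ->;
  rewrite ?(Bp, B1, B2, B3') !inE => /or3P[] -> ; rewrite ?orbT //.
case/or4P => [/eqP ee|/eqP ee|/eqP ee|/or3P[]/eqP ee].
- by apply: (pair2 p q3); rewrite // 1?eq_sym // ee ?Bp ?B3' !inE eqxx.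
- by apply: (pair2 p q1); rewrite // 1?eq_sym // ee ?Bp ?B1 !inE eqxx ?orbT.
- by apply: (pair2 p q2); rewrite // 1?eq_sym // ee ?Bp ?B2 !inE eqxx ?orbT.
- by apply: (pair2 q1 q2); rewrite // ee ?B1 ?B2 !inE eqxx ?orbT.
- by apply: (pair2 q2 q3); rewrite // ee ?B2 ?B3' !inE eqxx ?orbT.
- by apply: (pair2 q1 q3); rewrite // ee ?B1 ?B3' !inE eqxx ?orbT.
Qed.

(* The three triangles at [c] form a K4 with outer edge [ab]; if [ab] lay on a
   4-face, that face together with [c] would contain a 5-cycle with a chord. *)
Lemma m_eq2 p : p \in P3 -> m p = 2 ->
  exists g, [/\ g \in B p, t g = 1 & exists2 q, q \in P5 & g \in B q].
Proof.
move=> p3 m2; have [pP B3] := P3P p3.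
have /subsetPn[g gp ngs] : ~~ (B p \subset shared).
  apply: contra_eqN m2 => sub; rewrite /m (_ : [set _ in _ | _] = B p) ?B3 //.
  by apply/setP => e; rewrite inE; case: (boolP (e \in B p)) => //= /(subsetP sub).
have sh e : e \in B p -> e != g -> exists q, [/\ q \in P3, q != p & e \in B q].
  move=> ep neg; apply/(sharedP p3 ep); apply: contra_eqT m2 => nsh.
  have : [set e in B p | e \in shared] \subset B p :\ g :\ e.
    apply/subsetP => x; rewrite !inE => /andP[xp xs]; rewrite xp andbT.
    by apply/andP; split; [apply: contraNneq nsh|apply: contraNneq ngs] => <-;
      rewrite inE.
  move/subset_leq_card; rewrite -/(m p).
  have := cardsD1 g (B p); rewrite gp B3 add1n => /succn_inj c1.
  have := cardsD1 e (B p :\ g); rewrite in_setD1 neg ep -c1 add1n => /succn_inj <-.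
  by case: (m p) => [|[|]].
have /eqP/cards2P[a [b [nab ex]]] := pairB pP gp; rewrite {g}ex in gp ngs sh *.
have [c [_ nca ncb Bp]] := face3 p3 gp.
have [||q1 [q13 nq1 bc1]] := sh [set b; c]; first by rewrite Bp !inE eqxx orbT.
  apply/doubleton_eqP => -[[? ?]|[? ?]]; subst; by rewrite eqxx in nca.
have [||q2 [q23 nq2 ac2]] := sh [set a; c]; first by rewrite Bp !inE eqxx !orbT.
  apply/doubleton_eqP => -[[? ?]|[? ?]]; subst; by rewrite eqxx in ncb.
have [[bcp acp]] : [set b; c] \in B p /\ [set a; c] \in B p.
  by rewrite !Bp !inE !eqxx ?orbT.
have [[q1P q1c] [q2P q2c]] := (P3P q13, P3P q23).
have [r [rP nrp gr]] := face_other pP gp.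
have nr3 : r \notin P3.
  by apply: contra ngs => r3; apply/(sharedP p3 gp); exists r.
have tg : t [set a; b] = 1.
  have : 0 < t [set a; b] by apply/card_gt0P; exists p; rewrite inE p3.
  by have := t_le2 [set a; b]; move: ngs; rewrite inE; case: (t _) => [|[|[|]]].
exists [set a; b]; split=> //; exists r => //; rewrite inE rP /=.
have := face_ge3 rP; rewrite leq_eqVlt => /orP[/eqP r3|].
  by rewrite inE rP -r3 eqxx in nr3.
rewrite leq_eqVlt => /orP[/eqP r4|//].
have [e er|x [y [U bxr xyr yar]]] := even_edges4 _ (evB rP) (esym r4) gr.
  exact: pairB er.
(* The apex [c] is off the 4-face: otherwise [bc] or [ac] would lie on [r] besides [p] and its other
   triangle, hence on three faces. *)
have [ncx ncy] : c != x /\ c != y.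
  split; apply/negP => /eqP cxy.
    rewrite -cxy in bxr; have := face_two pP q1P rP _ bcp bc1 bxr.
    rewrite eq_sym nq1 (negbTE nrp) => /(_ isT) /eqP rq.
    by rewrite rq q13 in nr3.
  rewrite -cxy setUC in yar; have := face_two pP q2P rP _ acp ac2 yar.
  rewrite eq_sym nq2 (negbTE nrp) => /(_ isT) /eqP rq.
  by rewrite rq q23 in nr3.
case: (no_theta (x0 := a) (x1 := c) (x2 := b) (x3 := x) (x4 := y)).
- have nac : a != c by rewrite eq_sym.
  move: U; rewrite /= !inE !negb_or nac ncb ncx ncy.
  by move=> /and4P[/and3P[-> -> ->] /andP[-> ->] -> _].
- exact: inE_B acp.
- by rewrite setUC; exact: inE_B bcp.
- exact: inE_B bxr.
- exact: inE_B xyr.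
- exact: inE_B yar.
- exact: inE_B gp.
Qed.

Lemma double_count (A : {set W}) (X : {set {set V}}) :
  \sum_(p in A) #|[set e in B p | e \in X]| = \sum_(e in X) #|[set q in A | e \in B q]|.
Proof.
under eq_bigr do rewrite -sum1_card.
under [RHS]eq_bigr do rewrite -sum1_card.
rewrite (exchange_big_dep (mem X)) /=; last by move=> p e _; rewrite inE => /andP[].
apply: eq_bigr => e eX; apply: eq_bigl => p; rewrite !inE eX andbT //.
Qed.

Lemma discharging : 5 * #|P| <= 3 * #|E|.
Proof.
have inX (X : {set {set V}}) p : B p \subset X -> [set e in B p | e \in X] = B p.
  by move=> sub; apply/setP => e; rewrite inE;
    case: (boolP (e \in B p)) => //= /(subsetP sub).
have cntP : \sum_(p in P) #|B p| <= 2 * #|E|.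
  under eq_bigr => p pP do rewrite -(inX E p (subE pP)).
  rewrite double_count mulnC -sum_nat_const; apply: leq_sum => e eE.
  have [->|/set0Pn[p]] := eqVneq [set q in P | e \in B q] set0; first by rewrite cards0.
  by rewrite inE => /andP[pP ep]; rewrite (two pP ep).
have cnt3 : 3 * #|P3| = \sum_(e in E) t e.
  rewrite -double_count mulnC -sum_nat_const; apply: eq_bigr => p /P3P[pP B3].
  by rewrite inX ?subE.
pose e2 := #|[set e in E | e \in shared]|.
have cntm : \sum_(p in P3) m p = 2 * e2.
  rewrite /e2 (eq_bigr (fun p => #|[set e in B p | e \in [set e in E | e \in shared]]|)).
    rewrite double_count mulnC -sum_nat_const; apply: eq_bigr => e.
    by rewrite !inE => /andP[_ /eqP].
  move=> p /P3P[pP _]; rewrite /m; apply: eq_card => e; rewrite !inE.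
  by case: (boolP (e \in B p)) => //= /(inE_B pP) ->.
pose T2 := [set p in P3 | m p == 2].
have sumt : \sum_(e in E) t e <= #|E| + e2.
  have -> : e2 = \sum_(e in E) (if t e == 2 then 1 else 0).
    rewrite -big_mkcondr /e2 -sum1_card; apply: eq_bigl => e.
    by rewrite !inE.
  rewrite -sum1_card -big_split /=; apply: leq_sum => e eE.
  by have := t_le2 e; case: (t e) => [|[|[|]]].
have summ : \sum_(p in P3) m p <= #|P3| + #|T2|.
  have -> : #|T2| = \sum_(p in P3) (if m p == 2 then 1 else 0).
    rewrite -big_mkcondr -sum1_card; apply: eq_bigl => p.
    by rewrite inE.
  rewrite -sum1_card -big_split /=; apply: leq_sum => p p3.
  by have := m_le2 p3; case: (m p) => [|[|[|]]].
have cntT : #|T2| <= \sum_(q in P5) #|B q|.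
  (* By [m_eq2] each triangle of [T2] owns an edge of [X]. Since [t e == 1], no edge of [X] serves
     two triangles, and each lies on a face in [P5]. *)
  pose X := [set e | (t e == 1) && [exists q in P5, e \in B q]].
  apply: (@leq_trans #|X|).
    rewrite -sum1_card; apply: (@leq_trans (\sum_(p in T2) #|[set e in B p | e \in X]|)).
      apply: leq_sum => p; rewrite inE => /andP[p3 /eqP m2].
      have [g [gp tg [q q5 gq]]] := m_eq2 p3 m2.
      apply/card_gt0P; exists g; rewrite !inE gp tg /=.
      by apply/exists_inP; exists q.
    rewrite double_count -[leqRHS]sum1_card; apply: leq_sum => e;
      rewrite inE => /andP[/eqP <- _].
    by apply: subset_leq_card; apply/subsetP => p; rewrite !inE => /andP[/andP[-> _] ->].
  rewrite -(eq_bigr _ (fun q q5 => congr1 (fun A : {set _} =>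
    #|A|) (inX setT q (subsetT _)))).
  rewrite double_count (big_setID X) /= setTI; apply: leq_trans (leq_addr _ _).
  rewrite -sum1_card; apply: leq_sum => e; rewrite inE => /andP[_ /exists_inP[q q5 eq]].
  by apply/card_gt0P; exists q; rewrite inE q5.
have [cP cS] : #|P| = #|P3| + #|P4| + #|P5| /\
   \sum_(p in P) #|B p| = 3 * #|P3| + 4 * #|P4| + \sum_(p in P5) #|B p|.
  have split3 (f : W -> nat) : \sum_(p in P) f p =
      \sum_(p in P3) f p + \sum_(p in P4) f p + \sum_(p in P5) f p.
    rewrite (bigID (fun p => #|B p| == 3)) /= -addnA; congr (_ + _).
      by apply: eq_bigl => p; rewrite inE.
    rewrite (bigID (fun p => #|B p| == 4)) /=; congr (_ + _); apply: eq_bigl => p;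
      rewrite inE.
      by case: (p \in P) => //=; case: eqP => [->|] //=; rewrite andbF.
    by case: (boolP (p \in P)) => //= /face_ge3; case: #|_| => [|[|[|[|[|]]]]].
  split; first by rewrite -!sum1_card split3.
  rewrite split3; congr (_ + _ + _); rewrite mulnC -sum_nat_const; apply: eq_bigr => p;
    by rewrite inE => /andP[_ /eqP].
have s5 : 5 * #|P5| <= \sum_(q in P5) #|B q|.
  by rewrite mulnC -sum_nat_const; apply: leq_sum => p; rewrite inE => /andP[].
(* Let s be the sum of [#|B q|] over [P5]. The counts give [5 |P3| <= 2 |E| + s] and
   [3 |P3| + 4 |P4| + s <= 2 |E|]. Half of the first plus five halves of the second, with
   [5 |P5| <= s], is twice the claim. *)
by clear -cntP cnt3 cntm sumt summ cntT cP cS s5; lia.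
Qed.

End Discharging.

(** * Faces of a plane drawing *)

(** [bool] serves as the field with two elements: its addition is exclusive or, so sums in it are
    parities. *)
Lemma odd_sum (I : finType) (P f : pred I) :
  \sum_(i | P i) f i = odd #|[set i | P i & f i]| :> bool.
Proof.
rewrite -sum1_card (big_morph odd oddD (erefl : odd 0 = (0 : bool))) /=.
rewrite [RHS](eq_bigl (fun i => P i && f i)); last by move=> i; rewrite inE.
by rewrite [RHS]big_mkcondr; apply: eq_bigr => i _; case: (f i).
Qed.

Lemma sum_consec (f : nat -> bool) n : \sum_(i < n) (f i + f i.+1) = f 0%N + f n.
Proof.
elim: n => [|n IH]; first by rewrite big_ord0; case: (f _).
by rewrite big_ord_recr /= IH; case: (f 0%N); case: (f n); case: (f _).
Qed.

(** * A lower bound for the size of the cycle space *)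

Section CycleCount.
Variables (V : finType) (E : {set {set V}}) (v0 : V).
Hypothesis pairE : forall e, e \in E -> #|e| = 2%N.

Let par (A : {set {set V}}) v : bool := \sum_(e in A) (v \in e).

Lemma parE A v : par A v = odd #|[set e in A | v \in e]|.
Proof. by rewrite /par odd_sum. Qed.

Lemma par_handshake (A : {set {set V}}) : A \subset E -> \sum_v par A v = 0.
Proof.
move=> AE; rewrite exchange_big big1 // => e eA.
rewrite odd_sum (_ : [set _ | _ & _] = e); first by rewrite pairE // (subsetP AE).
by apply/setP => v; rewrite inE.
Qed.

Lemma even_edges_off (A : {set {set V}}) : A \subset E -> (forall v, v != v0 ->
  par A v = 0) -> even_edges A.
Proof.
move=> AE par0; have := par_handshake AE; rewrite (bigD1 v0) //= big1 // addr0 => p0.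
apply/forallP => v; rewrite -parE; have [->|/par0 ->//] := eqVneq v v0.
by rewrite p0.
Qed.

(** Send an edge set to the set of its odd-degree vertices other than [v0]. A nonempty fibre is
    carried into the even sets by the symmetric difference with one of its members, since the
    handshake identity settles the parity at [v0]; there are at most [2 ^ #|V|.-1] fibres. *)
Lemma cycle_count :
  (2 ^ #|E| <= #|[set C : {set {set V}} | (C \subset E) && even_edges C]| * 2 ^
    #|V|.-1)%N.
Proof.
pose bd (A : {set {set V}}) := [set v | (v != v0) && par A v].
pose D := powerset (~: [set v0]).
have -> : (2 ^ #|V|.-1 = #|D|)%N.
  by rewrite card_powerset cardsC1.
rewrite -card_powerset -sum1_card.
rewrite (partition_big bd (mem D)) /=; last first.
  move=> A _; rewrite inE; apply/subsetP => v; rewrite !inE => /andP[//].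
rewrite mulnC -sum_nat_const; apply: leq_sum => d _.
have [[A0 A0E /eqP A0d]|none] := pselect (exists2 A0, A0 \in powerset E & bd A0 == d);
  last first.
  by rewrite big_pred0 // => A; apply: contra_notF none => /andP[? ?]; exists A.
pose delta (A : {set {set V}}) := [set e | (e \in A) (+) (e \in A0)].
have deltaK : involutive delta.
  by move=> A; apply/setP => e; rewrite !inE -addbA addbb addbF.
rewrite sum1_card -(card_imset _ (inv_inj deltaK)); apply: subset_leq_card.
apply/subsetP => _ /imsetP[A /andP[AE /eqP Ad] ->]; rewrite !inE in AE A0E *.
have dE : delta A \subset E.
  apply/subsetP => e; rewrite inE; case: (boolP (e \in A)) => [/(subsetP AE)//|_] /=.
  exact: (subsetP A0E).
rewrite dE; apply: even_edges_off => // v nv.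
transitivity (par A v + par A0 v).
  rewrite /par big_mkcond [X in _ = X + _]big_mkcond [X in _ = _ + X]big_mkcond.
  rewrite -(@big_split bool 0 +%R); apply: eq_bigr => e _; rewrite inE.
  by case: (e \in A); case: (e \in A0); case: (v \in e).
have /setP/(_ v) : bd A = bd A0 by rewrite Ad A0d.
by rewrite !inE nv /= => ->; case: (par A0 v).
Qed.

End CycleCount.

(* With [A] enumerated by increasing [k], the sum telescopes. *)
Lemma telescope_sides (S : finType) (W : zmodType) (d : Order.disp_t) (O : orderType d)
    (k : S -> O) (lab : S -> W) (g : W -> bool) (w0 : W) (A : {set S}) :
  {in A &, injective k} ->
  \sum_(s in A) (g (w0 + \sum_(u in A | (k u < k s)%O) lab u) +
                 g (w0 + \sum_(u in A | (k u < k s)%O) lab u + lab s)) =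
  g w0 + g (w0 + \sum_(s in A) lab s) :> bool.
Proof.
elim/ltn_ind: {A}#|A| {-2}A (erefl #|A|) => n IH A An kinj.
have [A0|/set0Pn[s1 s1A]] := eqVneq A set0.
  by rewrite A0 !big_set0 addr0; case: (g w0).
pose s0 := [arg max_(s > s1 in A) k s]%O.
have [s0A s0max] : s0 \in A /\ forall s, s \in A -> (k s <= k s0)%O.
  by rewrite /s0; case: arg_maxP.
have lt0 s : s \in A :\ s0 -> (k s < k s0)%O.
  rewrite !inE => /andP[ns sA]; rewrite lt_neqAle s0max // andbT.
  by apply: contra ns => /eqP/kinj ->.
rewrite (big_setD1 s0) //= [X in w0 + X + lab s0](_ : _ = \sum_(s in A :\ s0) lab s);
  last first.
  apply: eq_bigl => u; rewrite !inE; case: eqVneq => [->|nu] /=;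
    first by rewrite ltxx andbF.
  by case: (boolP (u \in A)) => //= uA; rewrite lt0 // !inE nu.
rewrite [X in g (w0 + X)](_ : _ = \sum_(s in A :\ s0) lab s); last first.
  apply: eq_bigl => u; rewrite !inE; case: eqVneq => [->|nu] /=;
    first by rewrite ltxx andbF.
  by case: (boolP (u \in A)) => //= uA; rewrite lt0 // !inE nu.
under [X in _ + X]eq_bigr => s sA.
  rewrite (_ : \sum_(u in A | _) _ = \sum_(u in A :\ s0 | (k u < k s)%O) lab u);
    last first.
    apply: eq_bigl => u; rewrite !inE; case: eqVneq => [->|//] /=.
    by rewrite ltNge (ltW (lt0 _ sA)) andbF.
  over.
rewrite (IH #|A :\ s0|) //; last 2 first.
- by rewrite -An (cardsD1 s0 A) s0A.
- by move=> s u /setD1P[_ sA] /setD1P[_ uA]; apply: kinj.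
rewrite [in RHS](big_setD1 s0) //= [lab s0 + _]addrC [w0 + (_ + lab s0)]addrA.
set x := g _; set y := g _; set z := g _; by case: x; case: y; case: z.
Qed.

(* Segment [s] runs from vertex [a s] to vertex [b s] of the sweep, [key s j] is
   its height between vertices [j - 1] and [j], and [low s] is the sum of the
   labels of the segments below it, which labels the face just below [s]; the
   face just above [s] is labelled [low s + lab s]. *)
Section SweepFaces.
Variables (S : finType) (W : zmodType) (d : Order.disp_t) (O : orderType d).
Variables (a b : S -> nat) (key : S -> nat -> O) (lab : S -> W).
Hypothesis ltab : forall s, (a s < b s)%N.
Let active s j := (a s < j <= b s)%N.
Hypothesis key_inj : forall s u j, active s j -> active u j -> key s j = key u j -> s = u.
Hypothesis key_next : forall s u j, active s j -> active s j.+1 ->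
  active u j -> active u j.+1 ->
  (key u j < key s j)%O = (key u j.+1 < key s j.+1)%O.
Hypothesis key_star : forall s j, active s j -> active s j.+1 ->
  exists beta : bool,
  (forall u, b u = j -> (key u j < key s j)%O = beta) /\
  (forall u, a u = j -> (key u j.+1 < key s j.+1)%O = beta).
Hypothesis lab_star : forall j, \sum_(s | a s == j) lab s = \sum_(s | b s == j) lab s.

Let lower s j := \sum_(u | active u j && (key u j < key s j)%O) lab u.

(** The segments that end or start at vertex [j] lie all below [s] or all above it. In the first
    case [lab_star] makes what is lost equal to what is gained. *)
Lemma lower_step s j : (a s < j)%N -> (j < b s)%N -> lower s j = lower s j.+1.
Proof.
move=> asj jbs; have sj : active s j by rewrite /active asj ltnW.
have sj1 : active s j.+1 by rewrite /active ltnW.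
have [beta [betaL betaR]] := key_star sj sj1.
rewrite /lower (bigID (fun u => b u == j)) [RHS](bigID (fun u => a u == j)) /=;
  congr (_ + _).
  transitivity (if beta then \sum_(u | b u == j) lab u else 0).
    case: ifP => bT; last rewrite big_pred0 //; [apply: eq_bigl|] => u;
      case: eqP => bu; rewrite ?andbF // betaL // bT ?andbF // andbT /active bu leqnn
        andbT.
    by rewrite -bu ltab.
  transitivity (if beta then \sum_(u | a u == j) lab u else 0); first by rewrite lab_star.
  case: ifP => bT; last rewrite big_pred0 //; [apply: eq_bigl|] => u;
      case: eqP => au; rewrite ?andbF // betaR // bT ?andbF // andbT /active au ltnSn /=.
  by rewrite -au ltab.
apply: eq_bigl => u; case: (boolP (active u j)) => uj;
  case: (boolP (active u j.+1)) => uj1 /=.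
- rewrite (key_next sj sj1 uj uj1); congr andb.
  by move: uj uj1; rewrite /active; lia.
- by move: uj uj1; rewrite /active; lia.
- by move: uj uj1; rewrite /active; lia.
- by [].
Qed.

Definition low s := lower s (b s).

Lemma lower_low s j : active s j -> lower s j = low s.
Proof.
move=> /andP[aj jb]; rewrite /low.
suff H m : (m <= b s)%N -> (j <= m)%N -> lower s j = lower s m by apply: H.
elim: m => [|m IH] mb; first by rewrite leqn0 => /eqP ->.
rewrite leq_eqVlt => /orP[/eqP->//|jm]; rewrite IH ?(ltnW mb) //.
by apply: lower_step => //; apply: leq_trans aj _.
Qed.

Definition side (p : W) s : bool := (low s == p) (+) (low s + lab s == p).

(** On either side of vertex [j] the star is stacked above the same passing segments, with label sum
    [w0]. The sum of sides telescopes to the labels below and above the star, [w0] and [w0] plus the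
    sum of the star, and [lab_star] says that both agree on left and right. *)
Lemma side_even p j : \sum_(s | a s == j) side p s = \sum_(s | b s == j) side p s :> bool.
Proof.
pose pass u := active u j && active u j.+1.
have [beta betaP] : exists beta : S -> bool, forall u, pass u ->
   (forall s, b s = j -> (key u j < key s j)%O = beta u) /\
   (forall s, a s = j -> (key u j.+1 < key s j.+1)%O = beta u).
  have H u : exists bb : bool, pass u ->
     (forall s, b s = j -> (key u j < key s j)%O = bb) /\
     (forall s, a s = j -> (key u j.+1 < key s j.+1)%O = bb).
    case: (boolP (pass u)) => [/andP[uj uj1]|_]; last by exists true.
    have [bb [bL bR]] := key_star uj uj1; exists (~~ bb) => _; split=> s sj.
      rewrite -(bL s sj) -leNgt le_eqVlt; case: eqP => // /key_inj us.
      have := us uj; rewrite /active -sj ltab leqnn => /(_ isT) us'; move: uj1.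
      by rewrite /active us' sj ltnn andbF.
    rewrite -(bR s sj) -leNgt le_eqVlt; case: eqP => // /key_inj us.
    have := us uj1; rewrite /active sj ltnSn -sj ltab => /(_ isT) us'; move: uj.
    by rewrite /active us' sj ltnn.
  by have [f fP] := boolp.choice H; exists f.
pose w0 := \sum_(u | pass u && beta u) lab u.
have tel (c : S -> bool) i (g := fun w : W => w == p) :
    (forall s, c s -> active s i) ->
    (forall s, c s -> low s = w0 + \sum_(u in [set u | c u] | (key u i < key s i)%O) lab
      u) ->
    \sum_(s | c s) side p s = g w0 + g (w0 + \sum_(s | c s) lab s) :> bool.
  move=> ca cl; have := @telescope_sides S W d O (key^~ i) lab g w0 [set u | c u].
  under eq_bigl do rewrite inE.
  under [X in _ = _ + g (w0 + X)]eq_bigl do rewrite inE.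
  move=> <-; first by apply: eq_bigr => s cs; rewrite -cl.
  by move=> s u; rewrite !inE => cs cu; apply: key_inj; apply: ca.
rewrite (tel _ j.+1) ?(tel (fun s => b s == j) j) ?lab_star //.
- by move=> s /eqP <-; rewrite /active ltab leqnn.
- move=> s /eqP sj; have sa : active s j by rewrite /active -sj ltab leqnn.
  rewrite -(lower_low sa) /lower (bigID pass) /=; congr (_ + _).
    apply: eq_bigl => u; case: (boolP (pass u)) => pu; last by rewrite andbF.
    by rewrite (betaP u pu).1 // andbT; case/andP: pu => ->.
  apply: eq_bigl => u; rewrite /pass inE andbAC.
  by congr andb; rewrite /active; have := ltab u; lia.
- by move=> s /eqP <-; rewrite /active ltnSn ltab.
- move=> s /eqP sj; have sa : active s j.+1 by rewrite /active -sj ltab ltnSn.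
  rewrite -(lower_low sa) /lower (bigID pass) /=; congr (_ + _).
    apply: eq_bigl => u; case: (boolP (pass u)) => pu; last by rewrite andbF.
    by rewrite (betaP u pu).2 // andbT; case/andP: pu => _ ->.
  apply: eq_bigl => u; rewrite /pass inE andbAC.
  by congr andb; rewrite /active; have := ltab u; lia.
Qed.

(** This is connectivity of the dual: climbing the line just before [b s] from the outer label 0 up
    to [s] crosses segments at which [g] does not change. *)
Lemma low_connected (g : W -> bool) : (forall s, g (low s) = g (low s + lab s)) ->
  forall s, g (low s) = g 0.
Proof.
move=> gs s; have sa : active s (b s) by rewrite /active ltab leqnn.
pose A := [set u | active u (b s) && (key u (b s) < key s (b s))%O].
have := @telescope_sides S W d O (key^~ (b s)) lab g 0 A.
rewrite big1 => [H|u]; last first.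
  rewrite inE => /andP[ua us]; rewrite !add0r.
  rewrite (_ : \sum_(_ in A | _) _ = low u); first by rewrite gs; case: (g _).
  rewrite -(lower_low ua); apply: eq_bigl => v; rewrite inE -andbA; congr andb.
  by apply: andb_idl => vu; apply: lt_trans vu us.
have {}H : 0 = g 0 + g (0 + \sum_(s0 in A) lab s0) :> bool.
  by apply: H => u v; rewrite !inE => /andP[ua _] /andP[va _]; apply: key_inj.
move: H; rewrite add0r (_ : \sum_(_ in A) _ = low s).
  by case: (g 0); case: (g _).
by apply: eq_bigl => u; rewrite inE.
Qed.

End SweepFaces.

(** * Simple polygonal arcs and a generic sweep direction *)

Section Polylines.
Variable R : realType.
Notation point := 'rV[R]_2.

Lemma on_segment_l (p q : point) : on_segment p q p.
Proof. by exists 0; rewrite lexx ler01 subr0 scale1r scale0r addr0. Qed.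

Lemma on_segment_r (p q : point) : on_segment p q q.
Proof. by exists 1; rewrite lexx ler01 subrr scale1r scale0r add0r. Qed.

Lemma on_polylineP (a : point) s x : (0 < size s)%N ->
  on_polyline a s x <->
  exists2 i, (i < size s)%N & on_segment (nth 0 (a :: s) i) (nth 0 (a :: s) i.+1) x.
Proof.
elim: s a => // b [|c s] IH a _ /=.
  split=> [[H|->]|[[|i] //= _ H]]; [by exists 0%N | by exists 0%N => //;
    apply: on_segment_r | by left].
rewrite -/(on_polyline b (c :: s) x) IH //; split.
  by move=> [H|[i ib H]]; [exists 0%N | exists i.+1].
by move=> [[|i] /= ib H]; [left|right; exists i].
Qed.

Lemma simple_consec (a : point) s i : simple_polyline a s -> (i < size s)%N ->
  nth 0 (a :: s) i != nth 0 (a :: s) i.+1.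
Proof.
elim: s a i => //= b s IH a [|i] [nab H1 H2] //=.
by rewrite ltnS; apply: IH.
Qed.

Lemma simple_meet (a : point) s i j x : simple_polyline a s -> (i < j < size s)%N ->
  on_segment (nth 0 (a :: s) i) (nth 0 (a :: s) i.+1) x ->
  on_segment (nth 0 (a :: s) j) (nth 0 (a :: s) j.+1) x ->
  j = i.+1 /\ x = nth 0 (a :: s) j.
Proof.
elim: s a i j => [|b s IH] a [|i] [|j] //=.
  by rewrite ltn0 andbF.
  case=> nab H1 H2; rewrite ltnS => js xi xj.
  have xp : on_polyline b s x.
    by case: s js {IH H1 H2} xj => // c s js xj; apply/on_polylineP => //; exists j.
  have xb := H1 _ xi xp; subst x; case: j js xj => // j js xj.
  case: s {IH} H1 H2 js xj {xp xi} => // c s _ [nbc H1 _] js xj.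
  suff bc : b = c by rewrite bc eqxx in nbc.
  apply: H1; first exact: on_segment_l.
  by case: s js xj => // c' s js xj; apply/on_polylineP => //; exists j.
case=> nab H1 H2; rewrite !ltnS => ij xi xj.
by have [-> ->] := IH _ _ _ H2 ij xi xj.
Qed.

Lemma simple_on_pt (a : point) s i j : simple_polyline a s -> (i < size s)%N ->
  (j <= size s)%N ->
  on_segment (nth 0 (a :: s) i) (nth 0 (a :: s) i.+1) (nth 0 (a :: s) j) ->
  j = i \/ j = i.+1.
Proof.
move=> sim si; case: (ltngtP j i) => [ji|ij|->]; last by left.
  move=> _ H; have [|_ ji'] := @simple_meet a s j i _ sim _ (on_segment_l _ _) H.
    by rewrite ji.
  have [iE|nij] := eqVneq i j.+1.
    by have := simple_consec sim (ltn_trans ji si); rewrite ji' iE eqxx.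
  have [|iE _] := @simple_meet a s j i _ sim _ (on_segment_l _ _) H; first by rewrite ji.
  by rewrite iE eqxx in nij.
case: j ij => // j; rewrite ltnS leq_eqVlt => /orP[/eqP ->|ij] js H; first by right.
have [|_ ji'] := @simple_meet a s i j _ sim _ H (on_segment_r _ _); first by rewrite ij.
by have := simple_consec sim js; rewrite ji' eqxx.
Qed.

Lemma simple_pt_inj (a : point) s i j : simple_polyline a s -> (0 < size s)%N ->
  (i <= size s)%N -> (j <= size s)%N -> nth 0 (a :: s) i = nth 0 (a :: s) j -> i = j.
Proof.
move=> sim s0; wlog ij : i j / (i <= j)%N.
  move=> H; case: (leqP i j) => [ij|/ltnW ij] si sj e; first exact: H.
  by symmetry; apply: H.
move: ij; rewrite leq_eqVlt => /orP[/eqP //|ij] si sj e.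
have H : on_segment (nth 0 (a :: s) i) (nth 0 (a :: s) i.+1) (nth 0 (a :: s) j).
  by rewrite -e; apply: on_segment_l.
have is_ : (i < size s)%N by apply: leq_trans ij sj.
have [//|E] := simple_on_pt sim is_ sj H.
by have := simple_consec sim is_; rewrite e E eqxx.
Qed.

(** The sweep lines are the level sets of this function. For generic [th] none of them contains two
    of the given points, so no segment is parallel to them. *)
Definition shear (th : R) (p : point) : R := p 0 0 + th * p 0 1.

Lemma generic_shear (ps : seq point) : exists th, {in ps &, injective (shear th)}.
Proof.
(* Points with different ordinates collide only for a [th] in this finite list, and 1 plus the sum
   of the absolute values exceeds every entry of it. *)
pose bad := [seq ((q : point) 0 0 - (p : point) 0 0) / (p 0 1 - q 0 1) | p <- ps,
  q <- ps].
exists (1 + \sum_(x <- bad) `|x|) => p q pp qp; rewrite /shear.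
set th := 1 + _ => E; have thbad : th \notin bad.
  apply/negP => thb; suff : th < th by rewrite ltxx.
  rewrite {2}/th (big_rem _ thb) /= (le_lt_trans (ler_norm th)) //.
  have : 0 <= \sum_(y <- rem th bad) `|y| by rewrite sumr_ge0.
  by lra.
have [e1|ne1] := eqVneq (p 0 1) (q 0 1).
  apply/rowP => i; case: i => -[|[|//]] i;
    [have -> : Ordinal i = 0 by apply: val_inj | have ->
    : Ordinal i = 1 by apply: val_inj] => //.
  by move: E; rewrite e1 => /addIr.
case/negP: thbad; apply/allpairsP; exists (p, q); split=> //=.
have nz : p 0 1 - q 0 1 != 0 by rewrite subr_eq0.
apply: (mulIf nz); rewrite mulfVK //; move: E; nra.
Qed.

End Polylines.

Lemma affine_root (R : realType) (f : R -> R) (al be x y : R) :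
  (forall z, f z = al + be * z) -> x <= y -> (f x < 0) != (f y < 0) ->
  exists2 z, x <= z <= y & f z = 0.
Proof.
move=> fE xy; rewrite !fE => nxy.
have be0 : be != 0 by apply: contraNneq nxy => ->; rewrite !mul0r.
exists (- al / be); last by rewrite fE mulrC mulfVK // subrr.
have [bp|bn|be0'] := ltgtP 0 be; last by rewrite -be0' eqxx in be0.
  rewrite ler_pdivlMr // ler_pdivrMr //.
  case: (ltP (al + be * x) 0) nxy => h1; case: (ltP (al + be * y) 0) => h2 // _; nra.
rewrite ler_ndivlMr // ler_ndivrMr //.
case: (ltP (al + be * x) 0) nxy => h1; case: (ltP (al + be * y) 0) => h2 // _; nra.
Qed.

(** * The segments of a plane drawing form a sweep *)

Section Drawing.
Variables (R : realType) (V : finType) (G : sgraph V).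
Notation point := 'rV[R]_2.
Variables (pos : V -> point) (arc : {set V} -> point * seq point).
Hypothesis dr : plane_drawing G pos arc.
Let E := edges G.
(* [K e] vanishes off [E], so that [S] consists of the segments of edges of [G]. *)
Let K e := if e \in E then size (arc e).2 else 0%N.
Let pt e i : point := nth 0 ((arc e).1 :: (arc e).2) i.
Let S := {e : {set V} & 'I_(K e)}.
Let src (s : S) := pt (tag s) (tagged s).
Let dst (s : S) := pt (tag s) (tagged s).+1.

Lemma edge_pair e : e \in E -> #|e| = 2%N.
Proof. by move=> eE; have /forall_inP/(_ e eE)/eqP := edgesP G. Qed.

Lemma seg_edge (s : S) : tag s \in E.
Proof. by case: s => e i /=; have := ltn_ord i; rewrite {2}/K; case: ifP. Qed.

Lemma KE e : e \in E -> K e = size (arc e).2.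
Proof. by rewrite /K => ->. Qed.

Lemma seg_lt (s : S) : (tagged s < size (arc (tag s)).2)%N.
Proof. by rewrite -KE ?seg_edge. Qed.

Lemma arc_ptK e : pt e (size (arc e).2) = last (arc e).1 (arc e).2.
Proof. by rewrite (last_nth 0). Qed.

Lemma arc_ends_pt e : e \in E ->
  exists u v, [/\ e = [set u; v], u != v, pt e 0 = pos u & pt e (K e) = pos v].
Proof.
move=> eE; have [u [v [euv e0 eK]]] := arc_ends dr eE; exists u, v; split=> //.
  by move: (edge_pair eE); rewrite euv cards2; case: eqP.
by rewrite KE // arc_ptK.
Qed.

Lemma K_gt0 e : e \in E -> (0 < K e)%N.
Proof.
move=> eE; have [u [v [_ nuv e0 eK]]] := arc_ends_pt eE.
rewrite lt0n; apply: contraNneq nuv => K0; apply/eqP/(pos_inj dr).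
by rewrite -e0 -eK K0.
Qed.

Lemma arc_pos e w : e \in E -> (pt e 0 == pos w) || (pt e (K e) == pos w) = (w \in e).
Proof.
move=> eE; have [u [v [-> _ -> ->]]] := arc_ends_pt eE; rewrite !inE.
by rewrite !(inj_eq (pos_inj dr)) ![_ == w]eq_sym.
Qed.

Lemma arc_pt_inj e i j : e \in E -> (i <= K e)%N -> (j <= K e)%N -> pt e i = pt e j ->
  i = j.
Proof.
move=> eE; have := K_gt0 eE; rewrite KE // => K0 iK jK.
by apply: simple_pt_inj => //; apply: (arc_simple dr).
Qed.

Lemma seg_on_arc (s : S) x : on_segment (src s) (dst s) x ->
  on_polyline (arc (tag s)).1 (arc (tag s)).2 x.
Proof.
move=> H; apply/on_polylineP; first by rewrite -KE ?K_gt0 ?seg_edge.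
by exists (tagged s); first exact: seg_lt.
Qed.

Lemma seg_on_pt (s : S) j : (j <= K (tag s))%N ->
  on_segment (src s) (dst s) (pt (tag s) j) ->
    pt (tag s) j = src s \/ pt (tag s) j = dst s.
Proof.
move=> jK H; suff : j = tagged s :> nat \/ j = (tagged s).+1.
  by rewrite /src /dst => -[->|->]; [left|right].
apply: simple_on_pt H; first exact: (arc_simple dr (seg_edge s)).
  exact: seg_lt.
by rewrite -KE ?seg_edge.
Qed.

(** Distinct arcs share only positions of common end vertices, and two segments of one simple arc
    share only the bend between them. *)
Lemma seg_meet (s u : S) x : s != u ->
  on_segment (src s) (dst s) x -> on_segment (src u) (dst u) x -> x = src s \/ x = dst s.
Proof.
move=> nsu xs xu; have [tsu|ntsu] := eqVneq (tag s) (tag u); last first.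
  have [w] := arc_disjoint dr (seg_edge s) (seg_edge u) ntsu (seg_on_arc xs) (seg_on_arc
    xu).
  rewrite inE => /andP[ws _] xw; move: ws; rewrite -arc_pos ?seg_edge //.
  by case/orP=> /eqP E'; rewrite xw -E' in xs *; apply: seg_on_pt xs.
case: s u tsu nsu xs xu => [e i] [e' j] /= ee'; subst e'.
rewrite eq_Tagged /= -val_eqE /= neq_ltn /src /dst /= => nij xs xu.
have eE := seg_edge (Tagged _ i : S); have sim := arc_simple dr eE.
have szi := seg_lt (Tagged _ i : S); have szj := seg_lt (Tagged _ j : S).
case/orP: nij => ij.
  by have [|-> ->] := simple_meet sim _ xs xu; [rewrite ij | right].
by have [|-> ->] := simple_meet sim _ xu xs; [rewrite ij | left].
Qed.

Let allpts := [seq pos w | w : V] ++ flatten [seq (arc e).1 :: (arc e).2 | e : {set V}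
  in E].

Lemma pos_allpts w : pos w \in allpts.
Proof. by rewrite mem_cat map_f // mem_enum. Qed.

Lemma pt_allpts e i : e \in E -> (i <= K e)%N -> pt e i \in allpts.
Proof.
move=> eE iK; rewrite mem_cat; apply/orP; right; apply/flatten_mapP.
by exists e; rewrite ?mem_enum // mem_nth //= ltnS -KE.
Qed.

Lemma src_allpts s : src s \in allpts.
Proof. by apply: pt_allpts; [exact: seg_edge | apply: ltnW]. Qed.

Lemma dst_allpts s : dst s \in allpts.
Proof. by apply: pt_allpts; [exact: seg_edge | apply: ltn_ord]. Qed.

Variable th : R.
Let X := shear th.
Let Y (p : point) : R := p 0 1.
Hypothesis X_inj : {in allpts &, injective X}.

Lemma point_eq p q : X p = X q -> Y p = Y q -> p = q.
Proof.
rewrite /X /Y /shear => + yE; rewrite yE => /addIr xE.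
apply/rowP => i; case: i => -[|[|//]] i.
  by rewrite (_ : Ordinal i = 0) //; apply: val_inj.
by rewrite (_ : Ordinal i = 1) //; apply: val_inj.
Qed.

Lemma src_neq_dst s : X (src s) != X (dst s).
Proof.
apply/eqP => /X_inj - /(_ (src_allpts s) (dst_allpts s)).
move/arc_pt_inj => /(_ (seg_edge s) (ltnW (ltn_ord _)) (ltn_ord _)) /eqP.
by rewrite -[X in X == _]addn0 -addn1 eqn_add2l.
Qed.

Let lx s := Num.min (X (src s)) (X (dst s)).
Let rx s := Num.max (X (src s)) (X (dst s)).
Let h s x := Y (src s) + (Y (dst s) - Y (src s)) * (x - X (src s)) / (X (dst s) - X (src
  s)).

Lemma lxrxP s : [/\ lx s = X (src s), rx s = X (dst s) & X (src s) < X (dst s)] \/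
  [/\ lx s = X (dst s), rx s = X (src s) & X (dst s) < X (src s)].
Proof.
rewrite /lx /rx; have := src_neq_dst s.
by case: (ltgtP (X (src s)) (X (dst s))) => lt; [left|right|].
Qed.

Lemma h_src s : h s (X (src s)) = Y (src s).
Proof. by rewrite /h subrr mulr0 mul0r addr0. Qed.

Lemma h_dst s : h s (X (dst s)) = Y (dst s).
Proof. by rewrite /h mulfK ?subr_eq0 1?eq_sym ?src_neq_dst // addrC subrK. Qed.

Lemma h_point s x : lx s <= x <= rx s ->
  exists z, [/\ on_segment (src s) (dst s) z, X z = x & Y z = h s x].
Proof.
move=> xs; pose t := (x - X (src s)) / (X (dst s) - X (src s)).
have nz : X (dst s) - X (src s) != 0 by rewrite subr_eq0 eq_sym src_neq_dst.
exists ((1 - t) *: src s + t *: dst s); split.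
- exists t; split=> //; rewrite /t; case: (lxrxP s) xs => -[-> -> lt] /andP[h1 h2].
    by rewrite ler_pdivlMr ?ler_pdivrMr ?subr_gt0 // mul0r mul1r subr_ge0 h1 lerD2r h2.
  by rewrite ler_ndivlMr ?ler_ndivrMr ?subr_lt0 // mul0r mul1r subr_le0 h2 lerD2r h1.
- rewrite /X /shear !mxE /= -/(shear th _).
  transitivity ((1 - t) * X (src s) + t * X (dst s)); first by rewrite /X /shear; ring.
  have : t * (X (dst s) - X (src s)) = x - X (src s) by rewrite mulfVK.
  by move=> tE; rewrite -[RHS](subrK (X (src s))) -tE; ring.
- by rewrite /Y !mxE /h -mulrA -/t /Y; ring.
Qed.

Lemma no_cross s u x : s != u -> lx s <= x <= rx s -> lx u <= x <= rx u ->
  h s x = h u x ->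
  (x == lx s) || (x == rx s).
Proof.
move=> nsu /h_point[z [zs zx zy]] /h_point[z' [zu zx' zy']] hE.
have zz' : z = z' by apply: point_eq; rewrite ?zx ?zx' // zy zy'.
rewrite -zz' in zu; rewrite -zx.
by case: (seg_meet nsu zs zu) => ->; case: (lxrxP s) => -[-> ->]; rewrite eqxx ?orbT.
Qed.

(** The difference of heights is affine, so a change of sign would give a common point. [no_cross]
    puts such a point at an end of [s], hence only [s] must be interior throughout; [u] may start or
    end at [x] or [y], as [key_star] requires. *)
Lemma sign_const s u x y : s != u -> x <= y -> lx s < x -> y < rx s ->
  lx u <= x -> y <= rx u -> (h u x < h s x) = (h u y < h s y).
Proof.
move=> nsu xy sx sy ux uy; apply/eqP; apply: contraT => nE.
pose f z := h u z - h s z.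
pose be := (Y (dst u) - Y (src u)) / (X (dst u) - X (src u)) - (Y (dst s) - Y (src s)) /
  (X (dst s) - X (src s)).
have [||z /andP[xz zy] fz] := @affine_root R f (f 0) be x y _ xy.
- by move=> z; rewrite /f /h /be; ring.
- by rewrite /f !subr_lt0.
have := @no_cross s u z nsu; rewrite (ltW (lt_le_trans sx xz)) (ltW (le_lt_trans zy sy)).
rewrite (le_trans ux xz) (le_trans zy uy) => /(_ isT isT).
rewrite (gt_eqF (lt_le_trans sx xz)) (lt_eqF (le_lt_trans zy sy)) /=.
by move/eqP: fz; rewrite subr_eq0 => /eqP -> /(_ erefl).
Qed.

(** Times of the sweep are ranks of sheared abscissas; bends count as vertices of the sweep, so that
    segments are straight between their two times. *)
Let cs := sort <=%R (undup [seq X p | p <- allpts]).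
Let c j : R := nth 0 cs j.
Let rk p := index (X p) cs.

Lemma cs_sorted : sorted <%R cs.
Proof. by rewrite lt_sorted_uniq_le sort_uniq undup_uniq sort_le_sorted. Qed.

Lemma mem_cs p : p \in allpts -> X p \in cs.
Proof. by move=> pP; rewrite mem_sort mem_undup map_f. Qed.

Lemma rk_lt_size p : p \in allpts -> (rk p < size cs)%N.
Proof. by move=> pP; rewrite index_mem mem_cs. Qed.

Lemma c_rk p : p \in allpts -> c (rk p) = X p.
Proof. by move=> pP; rewrite /c nth_index ?mem_cs. Qed.

Lemma c_le i j : (i <= j)%N -> (j < size cs)%N -> c i <= c j.
Proof.
by move=> ij jn; rewrite (lt_sorted_leq_nth _ cs_sorted) // inE (leq_ltn_trans ij).
Qed.

Lemma c_lt i j : (i < j)%N -> (j < size cs)%N -> c i < c j.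
Proof.
by move=> ij jn; rewrite (lt_sorted_ltn_nth _ cs_sorted) // inE (ltn_trans ij).
Qed.

Lemma rk_inj p q : p \in allpts -> q \in allpts -> rk p = rk q -> p = q.
Proof. by move=> pP qP pq; apply: X_inj => //; rewrite -!c_rk // pq. Qed.

Let a s := minn (rk (src s)) (rk (dst s)).
Let b s := maxn (rk (src s)) (rk (dst s)).

Lemma rk_mono p q : p \in allpts -> q \in allpts -> X p < X q -> (rk p < rk q)%N.
Proof.
by move=> pP qP; rewrite ltNge [(_ < _)%N]ltnNge; apply: contra => qp;
  rewrite -!c_rk // c_le // rk_lt_size.
Qed.

Lemma abP s : [/\ c (a s) = lx s, c (b s) = rx s, (a s < b s)%N & (b s < size cs)%N].
Proof.
have [ps pd] := (src_allpts s, dst_allpts s); rewrite /a /b.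
have [rs rd] := (rk_lt_size ps, rk_lt_size pd).
case: (lxrxP s) => -[-> -> lt]; have rlt := rk_mono _ _ lt.
  by have {}rlt := rlt ps pd; rewrite (minn_idPl (ltnW rlt)) (maxn_idPr (ltnW rlt)) !c_rk.
by have {}rlt := rlt pd ps; rewrite (minn_idPr (ltnW rlt)) (maxn_idPl (ltnW rlt)) !c_rk.
Qed.

Lemma ltab s : (a s < b s)%N. Proof. by case: (abP s). Qed.

Lemma star_rk s p : p \in allpts ->
  ((a s == rk p) + (b s == rk p) = (src s == p) + (dst s == p) :> bool).
Proof.
move=> pP; have [ps pd] := (src_allpts s, dst_allpts s).
have rkE q : q \in allpts -> (q == p) = (rk q == rk p).
  by move=> qP; apply/eqP/eqP => [->//|]; apply: rk_inj.
rewrite !rkE // /a /b; case: (leqP (rk (src s)) (rk (dst s))) => // _.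
by rewrite addrC.
Qed.

Let mid j : R := (c j.-1 + c j) / 2%:R.

Lemma midP i : (0 < i < size cs)%N -> c i.-1 < mid i < c i.
Proof.
case: i => // i; move=> /andP[_ ilt]; have := c_lt (ltnSn i) ilt; rewrite /mid /=.
by move=> lt; apply/andP; split; lra.
Qed.

Let active s j := (a s < j <= b s)%N.

Lemma active_mid s j : active s j -> lx s < mid j < rx s.
Proof.
have [<- <- _ bs] := abP s; move=> /andP[aj jb].
have /andP[m1 m2] : c j.-1 < mid j < c j.
  by apply: midP; rewrite (leq_ltn_trans _ aj) // (leq_ltn_trans jb).
apply/andP; split.
  apply: le_lt_trans m1; apply: c_le; first by rewrite -ltnS (ltn_predK aj).
  exact: leq_ltn_trans (leq_pred _) (leq_ltn_trans jb bs).
by apply: lt_le_trans m2 _; apply: c_le.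
Qed.

Let key s j := h s (mid j).

Lemma key_inj s u j : active s j -> active u j -> key s j = key u j -> s = u.
Proof.
move=> /active_mid/andP[s1 s2] /active_mid/andP[u1 u2] kE; apply/eqP;
  apply: contraT => nsu.
have s12 : lx s <= mid j <= rx s by rewrite !ltW.
have u12 : lx u <= mid j <= rx u by rewrite !ltW.
have := no_cross nsu s12 u12 kE.
by rewrite gt_eqF // lt_eqF.
Qed.

Lemma active_times s j : active s j -> active s j.+1 ->
  (c j.-1 < mid j /\ mid j < c j) /\ (c j < mid j.+1 /\ mid j.+1 < c j.+1).
Proof.
have [_ _ _ bs] := abP s; move=> /andP[aj _] /andP[_ jb].
have jn : (j.+1 < size cs)%N := leq_ltn_trans jb bs.
have j0 : (0 < j)%N := leq_ltn_trans (leq0n _) aj.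
have /andP[h1 h2] : c j.-1 < mid j < c j by apply: midP; rewrite j0 ltnW.
by have /andP[h3 h4] := midP (i := j.+1) jn.
Qed.

Lemma key_next s u j : active s j -> active s j.+1 -> active u j -> active u j.+1 ->
  (key u j < key s j) = (key u j.+1 < key s j.+1).
Proof.
move=> sj sj1 uj uj1; have [->|nsu] := eqVneq s u; first by rewrite !ltxx.
have /andP[s1 _] := active_mid sj; have /andP[_ s2] := active_mid sj1.
have /andP[u1 _] := active_mid uj; have /andP[_ u2] := active_mid uj1.
apply: sign_const; rewrite ?ltW //.
by have [_ [h1 _]] := active_times sj sj1; have [[_ h4] _] := active_times sj sj1;
  apply: lt_trans h4 h1.
Qed.

(** By genericity a single point [zc] lies at abscissa [c j], so all segments that end or start at
    time [j] do so in [zc], and [sign_const] keeps each of them on the side of [s] on which [zc]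
    lies. *)
Lemma key_star s j : active s j -> active s j.+1 ->
  exists beta : bool,
  (forall u, b u = j -> (key u j < key s j) = beta) /\
  (forall u, a u = j -> (key u j.+1 < key s j.+1) = beta).
Proof.
move=> sj sj1; pose zc := nth 0 allpts (find (fun p => X p == c j) allpts).
have hz u x : x = c j -> lx u <= x <= rx u -> (x == lx u) || (x == rx u) ->
  h u (c j) = Y zc.
  move=> -> {x} uc xu; have [p pP [cp <-]] : exists2 p,
    p \in allpts & X p = c j /\ Y p = h u (c j).
    case: (lxrxP u) xu => -[-> -> _] /orP[] /eqP ->;
      by [exists (src u); rewrite ?src_allpts ?h_src | exists (dst u);
        rewrite ?dst_allpts ?h_dst].
  suff -> : zc = p by [].
  have hp : has (fun p => X p == c j) allpts by apply/hasP; exists p => //; rewrite cp.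
  apply: X_inj => //; first by rewrite mem_nth // -has_find.
  by have /eqP := nth_find 0 hp; rewrite cp.
have /andP[s1 s2] := active_mid sj; have /andP[s3 s4] := active_mid sj1.
have [[h3 h4] [h1 h2]] := active_times sj sj1.
exists (Y zc < h s (c j)); split=> u uj.
  have [ca cb _ bu] := abP u; have uact : active u j by rewrite /active -uj ltab leqnn.
  have /andP[u1 u2] := active_mid uact.
  rewrite -(hz u (c j)) ?[X in h u X](erefl) //; last 2 first.
  - by rewrite -cb uj lexx andbT ltW // (lt_trans u1 h4).
  - by rewrite -cb uj eqxx orbT.
  apply: sign_const => //; [|exact: ltW|exact: lt_trans h1 s4|exact: ltW|by rewrite -cb
    uj].
  by apply: contraTneq sj1 => ->; rewrite /active uj ltnn andbF.
have [ca cb _ bu] := abP u; have uact : active u j.+1 by rewrite /active -uj ltab ltnSn.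
have /andP[u1 u2] := active_mid uact.
rewrite -(hz u (c j)) //; last 2 first.
- by rewrite -ca uj lexx /= ltW // (lt_trans h1 u2).
- by rewrite -ca uj eqxx.
symmetry; apply: sign_const => //;
  [|exact: ltW|exact: lt_trans s1 h4|by rewrite -ca uj|exact: ltW].
by apply: contraTneq sj => ->; rewrite /active uj ltnn.
Qed.

Lemma star_sum (psi : S -> bool) z : z \in allpts ->
  \sum_(s | a s == rk z) psi s + \sum_(s | b s == rk z) psi s =
  \sum_s psi s * ((src s == z) + (dst s == z)).
Proof.
move=> zP; rewrite big_mkcond [X in _ + X]big_mkcond -(@big_split bool 0 +%R);
  apply: eq_bigr => s _ /=.
rewrite -star_rk //; case: (psi s); case: (_ == _); case: (_ == _); done.
Qed.

(** Along an arc the indicators of [z] cancel in pairs at inner points, so a bend contributes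
    nothing and only the arcs that end in [z] are counted. *)
Lemma arc_sum (phi : {set V} -> bool) z : z \in allpts ->
  \sum_(s | a s == rk z) phi (tag s) + \sum_(s | b s == rk z) phi (tag s) =
  \sum_(e in E) (phi e && ((pt e 0 == z) || (pt e (K e) == z))) :> bool.
Proof.
move=> zP; rewrite star_sum // /src /dst.
rewrite -(@sig_big_dep _ _ _ _ (fun e => 'I_(K e)) xpredT (fun _ => xpredT)
  (fun e (i : 'I_(K e)) => phi e * ((pt e i == z) + (pt e i.+1 == z)))) /=.
rewrite [RHS]big_mkcond /=; apply: eq_bigr => e _.
rewrite -big_distrr /= (sum_consec (fun i => pt e i == z)).
case: ifP => eE; last first.
  by rewrite {1}/K eE; case: (phi e); case: (_ == _).
case: (phi e) => //=; case: (eqVneq (pt e 0) z) => [<-|_] /=; last by case: (_ == _).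
by case: eqP => // /arc_pt_inj - /(_ eE (leqnn _) (leq0n _)) K0; have := K_gt0 eE;
  rewrite K0.
Qed.

Lemma rkP s j : (a s == j) || (b s == j) -> exists2 z, z \in allpts & rk z = j.
Proof.
rewrite /a /b; have [ps pd] := (src_allpts s, dst_allpts s).
by case: leqP => _ /orP[] /eqP <-; by [exists (src s) | exists (dst s)].
Qed.

(* The dual of the cycle space, represented by functions supported on cycles. *)
Notation W := {ffun {set {set V}} -> bool}.

Definition cycle (C : {set {set V}}) := (C \subset E) && even_edges C.

Definition lab (s : S) : W := [ffun C : {set {set V}} => cycle C && (tag s \in C)].

Lemma incident_sum (C : {set {set V}}) w : C \subset E ->
  \sum_(e in E) ((e \in C) && ((pt e 0 == pos w) || (pt e (K e) == pos w))) =
  odd #|[set e in C | w \in e]| :> bool.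
Proof.
move=> CE; rewrite odd_sum; congr (odd #|pred_of_set _|); apply/setP => e; rewrite !inE.
case: (boolP (e \in E)) => eE /=; first by rewrite arc_pos.
by case: (boolP (e \in C)) => // /(subsetP CE); rewrite (negbTE eE).
Qed.

Lemma bool_add0 (x y : bool) : x + y = 0 -> x = y.
Proof. by case: x; case: y. Qed.

(** In characteristic two it is enough that the whole star sums to 0. At a bend this is [arc_sum];
    at a vertex it is the even degree of the cycle [C] there. *)
Lemma lab_star j : \sum_(s | a s == j) lab s = \sum_(s | b s == j) lab s.
Proof.
have [[z zP <-]|nz] := pselect (exists2 z, z \in allpts & rk z = j); last first.
  by rewrite !big_pred0 // => s; apply/negP => H; apply: nz; apply: (@rkP s);
    rewrite H ?orbT.
apply/ffunP => C; rewrite !sum_ffunE.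
under eq_bigr do rewrite ffunE.
under [RHS]eq_bigr do rewrite ffunE.
case: (boolP (cycle C)) => /= [/andP[CE evC]|_]; last by rewrite !big1.
apply: bool_add0; rewrite (@arc_sum (fun e => e \in C)) //.
have [[w ->]|nw] := pselect (exists w, z = pos w).
  by rewrite incident_sum //; have /forallP/(_ w)/negbTE := evC.
rewrite big1 // => e eE; have [u [v [_ _ -> ->]]] := arc_ends_pt eE.
apply: negbTE; apply/negP => /andP[_] /orP[] /eqP H; apply: nw;
  [by exists u | by exists v].
Qed.

Let lo := low a b key lab.
Let sd := side a b key lab.

Lemma side_star p z : z \in allpts -> \sum_s sd p s * ((src s == z) + (dst s == z)) = 0.
Proof.
move=> zP; rewrite -star_sum // (side_even ltab key_inj key_next key_star lab_star).
by case: (\sum_(_ | _) _).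
Qed.

(** In [side_star] at the bend [pt e i.+1] just two terms survive, those of the segments [i] and
    [j], because no other segment has an end there. *)
Lemma side_next p e (i : 'I_(K e)) (j : 'I_(K e)) : j = i.+1 :> nat ->
  sd p (Tagged _ i) = sd p (Tagged _ j).
Proof.
move=> ji; have eE : e \in E := seg_edge (Tagged _ i : S).
have iK : (i.+1 <= K e)%N by apply: ltn_ord.
have := side_star p (pt_allpts eE iK); set z := pt e i.+1.
have zend (s : S) k : (k <= K (tag s))%N -> pt (tag s) k = z -> tag s = e /\ k = i.+1.
  move=> kK kz; suff te : tag s = e.
    by split=> //; move: kK kz; rewrite te => kK; apply: arc_pt_inj.
  apply/eqP; apply: contraT => nte.
  have zs : on_polyline (arc (tag s)).1 (arc (tag s)).2 z.
    rewrite -kz; have := K_gt0 (seg_edge s); rewrite KE ?seg_edge // => sz.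
    apply/on_polylineP => //; case: (ltnP k (size (arc (tag s)).2)) => kl.
      by exists k => //; apply: on_segment_l.
    exists (size (arc (tag s)).2).-1; first by rewrite prednK.
    rewrite prednK // (_ : k = size (arc (tag s)).2); first exact: on_segment_r.
    by apply/eqP; rewrite eqn_leq kl -KE ?seg_edge // kK.
  have ze : on_polyline (arc e).1 (arc e).2 z.
    by apply: (@seg_on_arc (Tagged _ i)); apply: on_segment_r.
  have [w] := arc_disjoint dr (seg_edge s) eE nte zs ze.
  rewrite inE => /andP[_ we] zw; move: we; rewrite -arc_pos // -zw => /orP[] /eqP.
    by move/arc_pt_inj => /(_ eE (leq0n _) iK).
  by move/arc_pt_inj => /(_ eE (leqnn _) iK) Ke; have := ltn_ord j;
    rewrite (etrans ji (esym Ke)) ltnn.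
pose si : S := Tagged _ i; pose sj : S := Tagged _ j.
have nij : si != sj by rewrite eq_Tagged /= -val_eqE /= ji neq_ltn ltnSn.
rewrite (bigD1 si) //= (bigD1 sj) /=; last by rewrite eq_sym.
rewrite big1 ?addr0.
  rewrite /src /dst /= -/z ji -/z !eqxx.
  case: eqP => [H|_].
    have [_ /eqP] := zend si i (ltnW (ltn_ord i)) H.
    by rewrite -[X in X == _]addn0 -addn1 eqn_add2l.
  case: eqP => [H|_]; last by rewrite add0r addr0 !mulr1 => /bool_add0.
  have jK : (j.+1 <= K e)%N by apply: ltn_ord.
  have [_ /eqP] := zend sj j.+1 jK (etrans (congr1 (fun k => pt e k.+1) ji) H).
  by rewrite ji eqSS -[X in _ == X]addn0 -addn1 eqn_add2l.
move=> s /andP[nsi nsj]; case: eqP => [H|_].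
  have [te ti] := zend s (tagged s) (ltnW (ltn_ord _)) H; case/negP: nsj; apply/eqP.
  case: s te ti {nsi H} => e' k /= ? ; subst e' => ki.
  by congr Tagged; apply: val_inj; rewrite /= ki.
case: eqP => [H|_]; last by rewrite addr0 mulr0.
have [te ti] := zend s (tagged s).+1 (ltn_ord _) H; case/negP: nsi; apply/eqP.
case: s te ti {nsj H} => e' k /= ? ; subst e' => -[ki].
by congr Tagged; apply: val_inj; rewrite /= ki.
Qed.

Lemma side_const p (s u : S) : tag s = tag u -> sd p s = sd p u.
Proof.
suff H e (i : 'I_(K e)) (i0 : 'I_(K e)) : i0 = 0%N :> nat ->
    sd p (Tagged _ i) = sd p (Tagged _ i0).
  case: s u => [e i] [e' j] /= ee'; subst e'.
  have K0 : (0 < K e)%N by apply: leq_ltn_trans (ltn_ord i).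
  by rewrite !(H e _ (Ordinal K0)).
case: i => i; elim: i => [|i IH] iK i00.
  by congr (sd p (Tagged _ _)); apply: val_inj.
by rewrite -(IH (ltnW iK) i00); symmetry; apply: side_next.
Qed.

(** * Face labels, their boundaries and Euler's inequality *)

Definition bdry (p : W) : {set {set V}} :=
  [set e in E | [exists s : S, (tag s == e) && sd p s]].

Lemma bdry_side p (s : S) : (tag s \in bdry p) = sd p s.
Proof.
rewrite inE seg_edge /=; apply/existsP/idP => [[u /andP[/eqP us]]|sp].
  by rewrite (side_const p us).
by exists s; rewrite eqxx.
Qed.

Lemma bdry_even p : even_edges (bdry p).
Proof.
apply/forallP => w; rewrite -incident_sum; last by apply/subsetP => e;
  rewrite inE => /andP[].
rewrite -(@arc_sum (fun e => e \in bdry p)) ?pos_allpts //.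
under eq_bigr do rewrite bdry_side.
under [X in _ + X]eq_bigr do rewrite bdry_side.
rewrite (side_even ltab key_inj key_next key_star lab_star).
by case: (\sum_(_ | _) _).
Qed.

Definition seg0 e (eE : e \in E) : S := Tagged _ (Ordinal (K_gt0 eE)).

(** The label 0 of the outer face is put in explicitly, which also covers a graph without edges. *)
Definition faces : {set W} := (0 : W) |: ([set lo s | s : S] :|: [set lo s + lab s | s :
  S]).

Lemma lo_faces s : lo s \in faces.
Proof. by rewrite !inE imset_f ?orbT. Qed.

Lemma up_faces s : lo s + lab s \in faces.
Proof. by rewrite !inE (imset_f (fun s => lo s + lab s)) ?orbT. Qed.

Lemma zero_faces : (0 : W) \in faces.
Proof. by rewrite !inE eqxx. Qed.

(** When [lab s] is 0, that is, on a bridge, both sides carry one label and [s] bounds nothing;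
    otherwise exactly two labels have [s] on their boundary. *)
Lemma side_count (A : {set W}) s :
  odd #|[set q in A | sd q s]| = (lo s \in A) (+) (lo s + lab s \in A).
Proof.
have [l0|nl0] := eqVneq (lab s) 0.
  rewrite l0 addr0 addbb (_ : [set _ in _ | _] = set0) ?cards0 //.
  by apply/setP => q; rewrite !inE /sd /side -/(lo s) l0 addr0 addbb andbF.
have nlu : lo s != lo s + lab s by rewrite -[X in X != _]addr0 (inj_eq (addrI _)) eq_sym.
rewrite -(odd_sum (mem A)).
have E1 q : sd q s = (lo s == q) + (lo s + lab s == q) :> bool by [].
under eq_bigr do rewrite E1.
rewrite big_split; congr (_ (+) _); rewrite odd_sum.
  case: (boolP (_ \in A)) => lA; [rewrite (_ : [set _ | _ & _] = [set lo s]) ?cards1 //|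
    rewrite (_ : [set _ | _ & _] = set0) ?cards0 //]; apply/setP => q; rewrite !inE;
    case: (eqVneq (lo s) q) => [<-|];
      rewrite ?andbT ?andbF ?(negbTE lA) // eq_sym => /negbTE //.
case: (boolP (_ \in A)) => lA; [rewrite (_ : [set _ | _ & _] = [set lo s + lab s])
  ?cards1 //|
    rewrite (_ : [set _ | _ & _] = set0) ?cards0 //]; apply/setP => q; rewrite !inE;
    case: (eqVneq (lo s + lab s) q) => [<-|];
      rewrite ?andbT ?andbF ?(negbTE lA) // eq_sym => /negbTE //.
Qed.

Lemma bdry_two e p : p \in faces -> e \in bdry p ->
  #|[set q in faces | e \in bdry q]| = 2%N.
Proof.
move=> pf ep; have eE : e \in E by move: ep; rewrite inE => /andP[].
pose s := seg0 eE; have es q : (e \in bdry q) = sd q s := bdry_side q s.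
have sp : sd p s by rewrite -es.
have nle : lo s != lo s + lab s.
  by apply: contraTneq sp => le; rewrite /sd /side -/(lo s) -le addbb.
rewrite (_ : [set _ in _ | _] = [set lo s; lo s + lab s]); first by rewrite cards2 nle.
apply/setP => q; rewrite inE es in_set2 (eq_sym q) (eq_sym q) /sd /side -/(lo s).
case: (eqVneq (lo s) q) => [e1|_]; case: (eqVneq (lo s + lab s) q) => [e2|_] //=.
- by rewrite e2 e1 eqxx in nle.
- by rewrite -e1 lo_faces.
- by rewrite -e2 up_faces.
- by rewrite andbF.
Qed.

(** If every edge were covered an even number of times, membership in [A] would agree on the two
    sides of each segment, and by [low_connected] [A] would be empty or contain all labels. *)
Lemma bdry_indep (A : {set W}) : A \subset faces -> A != set0 -> (#|A| < #|faces|)%N ->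
  exists e, odd #|[set q in A | e \in bdry q]|.
Proof.
move=> Af /set0Pn[q qA] Al.
have [[e He]|none] := pselect (exists e, odd #|[set q in A | e \in bdry q]|);
  first by exists e.
have gs s : (lo s \in A) = (lo s + lab s \in A).
  apply: bool_add0; rewrite -[LHS]side_count; apply: negbTE; apply/negP => H; apply: none.
  by exists (tag s); under eq_finset do rewrite bdry_side.
have gl := low_connected ltab key_inj key_next key_star lab_star gs.
have all0 r : r \in faces -> (r \in A) = ((0 : W) \in A).
  rewrite !inE => /or3P[/eqP->//|/imsetP[s _ ->]|/imsetP[s _ ->]]; first exact: gl.
  by rewrite -gs; apply: gl.
have A0 : (0 : W) \in A by rewrite -(all0 q) // (subsetP Af).
move: Al; rewrite ltnNge subset_leq_card //.
by apply/subsetP => r rf; rewrite all0.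
Qed.

(* The labels of the two faces at a segment differ by the label of its edge, so a
   cycle is determined by the values of the face labels on it. *)
Lemma cycles_le_faces :
  (#|[set C : {set {set V}} | (C \subset E) && even_edges C]| <= 2 ^ #|faces|.-1)%N.
Proof.
have -> : #|faces|.-1 = #|faces :\ (0 : W)| by rewrite (cardsD1 (0 : W) faces) zero_faces.
rewrite -card_powerset.
pose val_ (C : {set {set V}}) := [set p in faces :\ (0 : W) | (p : W) C].
rewrite -(@card_in_imset _ _ val_).
  apply: subset_leq_card; apply/subsetP => _ /imsetP[C _ ->]; rewrite inE.
  by apply/subsetP => p; rewrite inE => /andP[].
move=> C C'; rewrite !inE => cC cC' /setP vE.
have fE p : p \in faces -> p C = p C'.
  move=> pf; have [->|np] := eqVneq p 0; first by rewrite !ffunE.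
  by have := vE p; rewrite !inE np /=; move: pf; rewrite !inE (negbTE np) /= => -> /=.
apply/setP => e; case: (boolP (e \in E)) => eE; last first.
  case/andP: cC => /subsetP CE _; case/andP: cC' => /subsetP CE' _.
  by rewrite (negbTE (contra (CE e) eE)) (negbTE (contra (CE' e) eE)).
pose s := seg0 eE.
have := fE _ (up_faces s); rewrite !ffunE (fE _ (lo_faces s)) => /addrI.
by rewrite /cycle cC cC'.
Qed.

Lemma euler_faces : (0 < #|V|)%N -> (#|E| + 2 <= #|V| + #|faces|)%N.
Proof.
move=> V0; have [v0 _] : exists v0, v0 \in V by apply/card_gt0P.
have := leq_trans (cycle_count v0 edge_pair) (leq_mul cycles_le_faces (leqnn _)).
rewrite -expnD leq_exp2l // => H.
have F0 : (0 < #|faces|)%N by apply/card_gt0P; exists 0; apply: zero_faces.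
by move: H V0 F0; move: #|E| #|V| #|faces| => x y z; case: y => // y;
  case: z => // z /=; lia.
Qed.

Lemma drawing_bound : (5 <= #|V|)%N -> no_theta5 E -> (2 * #|E| + 10 <= 5 * #|V|)%N.
Proof.
move=> V5 nt; have V0 : (0 < #|V|)%N by apply: leq_trans V5.
(* With at most four labels Euler gives [|E| <= |V| + 2], enough because [|V| >= 5]. With more,
   every set of at most four labels is proper, as [bdry_indep] demands. *)
have := euler_faces V0; case: (leqP #|faces| 4) => F4.
  by move: F4 V5; move: #|E| #|V| #|faces| => x y z; lia.
have := @discharging V _ E faces bdry edge_pair _ _ bdry_two _ nt.
move=> D; have {}D : (5 * #|faces| <= 3 * #|E|)%N.
  apply: D => [p _|p _|A Af A0 A4]; [|exact: bdry_even|].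
    by apply/subsetP => e; rewrite inE => /andP[].
  by apply: bdry_indep => //; apply: leq_ltn_trans A4 F4.
by move: D; move: #|E| #|V| #|faces| => x y z; lia.
Qed.

End Drawing.

Lemma planar_theta5_free_bound (R : realType) (V : finType) (G : sgraph V) :
  (5 <= #|V|)%N -> planar R G -> family_free (Theta 5) G ->
  (2 * #|edges G| + 10 <= 5 * #|V|)%N.
Proof.
move=> V5 [pos [arc dr]] free.
have [th thP] := generic_shear ([seq pos w | w : V] ++
  flatten [seq (arc e).1 :: (arc e).2 | e : {set V} in edges G]).
exact: (drawing_bound dr thP V5 (theta_free_no_theta5 free)).
Qed.

(** * Drawing a graph along a sweep *)

(* A left-to-right sweep of an x-monotone drawing: vertex [k] is drawn at
   abscissa [k], a pair [(u, v)] with [u < v] stands for an edge, and [L] lists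
   from bottom to top the edges crossing the vertical line just before vertex
   [k]. At vertex [k] the consecutive edges [A] end and the edges [B] start. *)
Inductive sweep : nat -> seq (nat * nat) -> seq (nat * nat) -> Prop :=
| sweep_nil : sweep 0 [::] [::]
| sweep_step k X A B Y D of sweep k (X ++ A ++ Y) D
    & all (fun e => e.2 == k) A & all (fun e => e.2 != k) (X ++ Y)
    & all (fun e => (e.1 == k) && (k < e.2)%N) B & uniq B :
    sweep k.+1 (X ++ B ++ Y) (D ++ B).

(** The run is recorded as functions of time because the drawing of one edge uses the cuts at all
    abscissas that it passes. *)
Lemma sweep_history n L D : sweep n L D ->
  exists St X A B Y : nat -> seq (nat * nat),
  [/\ St 0%N = [::], St n = L,
   forall k, (k < n)%N -> St k = X k ++ A k ++ Y k /\ St k.+1 = X k ++ B k ++ Y k,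
   forall k, (k < n)%N -> [/\ all (fun e => e.2 == k) (A k),
     all (fun e => e.2 != k) (X k ++ Y k),
     all (fun e => (e.1 == k) && (k < e.2)%N) (B k) & uniq (B k)]
   & forall e, e \in D -> (e.1 < n)%N /\ e \in B e.1].
Proof.
elim=> [|k X A B Y D' _ [St [X' [A' [B' [Y' [S0 Sk HS HC HD]]]]]] cA cXY cB uB].
  by exists (fun=> [::]), (fun=> [::]), (fun=> [::]), (fun=> [::]), (fun=> [::]); split.
pose upd T (f : nat -> T) j x := fun i => if i == j then x else f i.
exists (upd _ St k.+1 (X ++ B ++ Y)), (upd _ X' k X), (upd _ A' k A), (upd _ B' k B),
  (upd _ Y' k Y).
rewrite /upd; split=> [//||i|i|e].
- by rewrite eqxx.
- rewrite ltnS leq_eqVlt => /orP[/eqP->|ik].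
    by rewrite !eqxx (ltn_eqF (ltnSn k)).
  by rewrite (ltn_eqF ik) (ltn_eqF (ltnW _)) ?ltnS // eqSS (ltn_eqF ik); apply: HS.
- rewrite ltnS leq_eqVlt => /orP[/eqP->|ik]; first by rewrite !eqxx.
  by rewrite (ltn_eqF ik); apply: HC.
- rewrite mem_cat => /orP[/HD[ek eB]|eB].
    by rewrite (ltn_eqF ek) ltnS ltnW.
  by have /allP/(_ e eB)/andP[/eqP -> _] := cB; rewrite eqxx ltnSn.
Qed.

(** At an abscissa the passing strands occupy distinct integer levels. Level [size X], between those
    of [X] and those of [Y], is kept for the vertex, where all strands ending or starting there are
    drawn. *)
Definition height (X Y : seq (nat * nat)) e : nat :=
  if e \in X then index e X else if e \in Y then ((size X).+1 + index e Y)%N else size X.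

Lemma height_mono (X M Y : seq (nat * nat)) e f : uniq (X ++ M ++ Y) ->
  e \in X ++ M ++ Y -> f \in X ++ M ++ Y ->
  (index e (X ++ M ++ Y) < index f (X ++ M ++ Y))%N ->
  (height X Y e <= height X Y f)%N /\
  (height X Y e = height X Y f -> e \in M /\ f \in M).
Proof.
move=> U eS fS; rewrite /height !index_cat.
move: U; rewrite !cat_uniq => /and3P[uX /hasPn dX /and3P[uM /hasPn dM uY]].
have XY g : g \in Y -> g \notin X by move=> gY; apply: dX; rewrite mem_cat gY orbT.
have MX g : g \in M -> g \notin X by move=> gM; apply: dX; rewrite mem_cat gM.
have YM g : g \in Y -> g \notin M by move=> gY; apply: dM.
move: eS fS; rewrite !mem_cat.
case: (boolP (e \in X)) => eX; case: (boolP (f \in X)) => fX //=.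
- by move=> _ _ lt; split; [apply: ltnW | move=> E; rewrite E ltnn in lt].
- move=> _ fS _; have := eX; rewrite -index_mem => ltX.
  by move: (index e X) (size X) (index f Y) ltX => i n j ltX; case: ifP => _; split; lia.
- by move=> _ _ lt; have := leq_trans lt (index_size f X); rewrite ltnNge leq_addr.
case: (boolP (e \in M)) => eM; case: (boolP (f \in M)) => fM //=.
- have [/negbTE-> /negbTE->] : e \notin Y /\ f \notin Y by split;
  [apply: contraL eM | apply: contraL fM]; apply: YM.
  by rewrite leqnn.
- move=> _ fY _; rewrite fY; have /negbTE-> : e \notin Y by apply: contraL eM; apply: YM.
  by split; lia.
- move=> eY _; rewrite ltn_add2l => lt; have := leq_trans lt (index_size f M).
  by rewrite ltnNge leq_addr.
by move=> -> ->; split; lia.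
Qed.

Lemma height_touch (X Y : seq (nat * nat)) e f : uniq (X ++ Y) -> e != f ->
  height X Y e = height X Y f -> (e \notin X ++ Y) && (f \notin X ++ Y).
Proof.
rewrite cat_uniq !mem_cat /height => /and3P[uX /hasPn dX uY] nef.
case: (boolP (e \in X)) => eX; case: (boolP (f \in X)) => fX.
- by move=> E; case/eqP: nef; rewrite -(nth_index e eX) E nth_index.
- move=> E; have := eX; rewrite -index_mem E; case: ifP => _; last by rewrite ltnn.
  by rewrite ltnNge -addn1 -addnA leq_addr.
- move=> E; have := fX; rewrite -index_mem -E; case: ifP => _; last by rewrite ltnn.
  by rewrite ltnNge -addn1 -addnA leq_addr.
case: (boolP (e \in Y)) => eY; case: (boolP (f \in Y)) => fY //=; last 2 first.
- by move/eqP; rewrite -addn1 -addnA -[X in _ == X]addn0 eqn_add2l.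
- by move/eqP; rewrite -addn1 -addnA -[X in X == _]addn0 eqn_add2l.
by move/addnI => E; case/eqP: nef; rewrite -(nth_index e eY) E nth_index.
Qed.

Section SweepDrawing.
Variables (R : realType) (n : nat) (D : seq (nat * nat)).
Variables St X A B Y : nat -> seq (nat * nat).
Hypotheses (St0 : St 0%N = [::]) (Stn : St n = [::]).
Hypothesis StE : forall k, (k < n)%N ->
  St k = X k ++ A k ++ Y k /\ St k.+1 = X k ++ B k ++ Y k.
Hypothesis cond : forall k, (k < n)%N -> [/\ all (fun e => e.2 == k) (A k),
     all (fun e => e.2 != k) (X k ++ Y k),
     all (fun e => (e.1 == k) && (k < e.2)%N) (B k) & uniq (B k)].
Hypothesis born : forall e, e \in D -> (e.1 < n)%N /\ e \in B e.1.
Let h k e := height (X k) (Y k) e.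

Lemma live_range k e : (k <= n)%N -> e \in St k -> (e.1 < k <= e.2)%N.
Proof.
elim: k => [|k IH] kn; first by rewrite St0.
have [SE SE'] := StE kn; have [cA cXY cB _] := cond kn.
rewrite SE' !mem_cat orbCA => /orP[/(allP cB)/andP[/eqP-> ->]|eXY];
  first by rewrite ltnSn.
have /andP[lt le] : (e.1 < k <= e.2)%N.
  by apply: IH (ltnW kn) _; rewrite SE !mem_cat orbCA eXY orbT.
rewrite -mem_cat in eXY; rewrite ltnS (ltnW lt) ltn_neqAle eq_sym le andbT.
exact: (allP cXY).
Qed.

Lemma St_uniq k : (k <= n)%N -> uniq (St k).
Proof.
elim: k => [|k IH] kn; first by rewrite St0.
have [SE SE'] := StE kn; have [_ _ cB uB] := cond kn.
have := IH (ltnW kn); rewrite SE SE' uniq_catCA cat_uniq => /and3P[_ _ uXY].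
rewrite uniq_catCA cat_uniq uB uXY andbT; apply/hasPn => e eXY.
apply/negP => /(allP cB)/andP[/eqP e1 _].
have /andP[] : (e.1 < k <= e.2)%N.
  by apply: live_range (ltnW kn) _; rewrite SE !mem_cat orbCA; move: eXY;
    rewrite mem_cat => ->; rewrite orbT.
by rewrite e1 ltnn.
Qed.

Lemma born_live e k : e \in D -> (e.1 < k <= e.2)%N -> (k <= n)%N -> e \in St k.
Proof.
move=> /born[en eB] /andP[]; elim: k => // k IH;
  rewrite ltnS leq_eqVlt => /orP[/eqP<-|ek] ke kn.
  by have [_ ->] := StE kn; rewrite !mem_cat eB orbT.
have [SE ->] := StE kn; have := IH ek (ltnW ke) (ltnW kn); rewrite SE !mem_cat.
have [cA _ _ _] := cond kn; case/or3P=> [->|/(allP cA)|->]; rewrite ?orbT //.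
by rewrite eq_sym ltn_eqF.
Qed.

Lemma born_lt e : e \in D -> (e.1 < e.2 < n)%N.
Proof.
move=> eD; have [en eB] := born eD; have [_ _ cB _] := cond en.
have /andP[_ e12] := allP cB _ eB; rewrite e12 ltnNge; apply/negP => ne.
by have := born_live eD (k := n); rewrite Stn en ne leqnn => /(_ isT isT).
Qed.

Lemma XY_range k e : (k < n)%N -> e \in X k ++ Y k -> (e.1 < k < e.2)%N.
Proof.
move=> kn eXY; have [SE _] := StE kn; have [_ cXY _ _] := cond kn.
have /andP[-> le] : (e.1 < k <= e.2)%N.
  by apply: live_range (ltnW kn) _; rewrite SE !mem_cat orbCA; move: eXY;
    rewrite mem_cat => ->; rewrite orbT.
by rewrite ltn_neqAle eq_sym le andbT; apply: (allP cXY).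
Qed.

Lemma XY_mem e k : e \in D -> (e.1 < k < e.2)%N -> e \in X k ++ Y k.
Proof.
move=> eD /andP[ek ke]; have /andP[_ en] := born_lt eD; have kn := ltn_trans ke en.
have := born_live eD (k := k); rewrite ek (ltnW ke) (ltnW kn) => /(_ isT isT).
have [SE _] := StE kn; have [cA _ _ _] := cond kn; rewrite SE !mem_cat.
by case/or3P=> [->|/(allP cA)|->]; rewrite ?orbT // eq_sym ltn_eqF.
Qed.

Lemma height_end e k : k = e.1 \/ k = e.2 -> (k < n)%N -> h k e = size (X k).
Proof.
move=> ek kn; have : e \notin X k ++ Y k.
  by apply/negP => /(XY_range kn); case: ek => ->; rewrite ltnn ?andbF.
by rewrite mem_cat negb_or /h /height => /andP[/negbTE-> /negbTE->].
Qed.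

(** Strands at equal height at [k] meet in vertex [k]. Meeting at [k.+1] as well, both would be the
    pair [(k, k.+1)]. *)
Lemma heights_split k e f : e \in D -> f \in D -> e != f -> (k.+1 < n)%N ->
  (e.1 <= k < e.2)%N -> (f.1 <= k < f.2)%N -> h k e = h k f -> h k.+1 e = h k.+1 f ->
    False.
Proof.
move=> eD fD nef kn /andP[ek ke] /andP[fk kf] h0 h1.
have k'n := ltnW kn.
have uXY j : (j < n)%N -> uniq (X j ++ Y j).
  move=> jn; have := St_uniq (ltnW jn); have [-> _] := StE jn.
  by rewrite uniq_catCA cat_uniq => /and3P[].
have /andP[eXY fXY] := height_touch (uXY _ k'n) nef h0.
have /andP[eXY' fXY'] := height_touch (uXY _ kn) nef h1.
have key g : g \in D -> (g.1 <= k)%N -> (k < g.2)%N -> g \notin X k ++ Y k ->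
    g \notin X k.+1 ++ Y k.+1 -> g = (k, k.+1).
  move=> gD gk kg n0 n1; rewrite [g]surjective_pairing; congr pair.
    by apply/eqP; rewrite eqn_leq gk leqNgt; apply: contra n0 => lt; apply: XY_mem;
      rewrite ?lt.
  by apply/eqP; rewrite eqn_leq kg andbT leqNgt; apply: contra n1 => lt; apply: XY_mem;
    rewrite ?lt ?ltnS ?gk.
by case/eqP: nef; rewrite (key e) // (key f).
Qed.

(** Between the two vertices the strands are ordered as in [St k.+1], and the heights at both ends
    follow this order weakly. *)
Lemma heights_mono k e f : e \in D -> f \in D -> (k.+1 < n)%N ->
  (e.1 <= k < e.2)%N -> (f.1 <= k < f.2)%N ->
  ((h k e <= h k f) && (h k.+1 e <= h k.+1 f))%N ||
  ((h k f <= h k e) && (h k.+1 f <= h k.+1 e))%N.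
Proof.
move=> eD fD kn ek fk; have [<-|nef] := eqVneq e f; first by rewrite !leqnn.
have eS : e \in St k.+1 by apply: born_live => //; apply: ltnW.
have fS : f \in St k.+1 by apply: born_live => //; apply: ltnW.
have [_ S1] := StE (ltnW kn); have [S2 _] := StE kn; have U := St_uniq (ltnW kn).
have key e' f' : e' \in St k.+1 -> f' \in St k.+1 ->
  (index e' (St k.+1) < index f' (St k.+1))%N ->
    (h k e' <= h k f')%N /\ (h k.+1 e' <= h k.+1 f')%N.
  move=> eS' fS' lt; split.
    by rewrite S1 in eS' fS' lt U; have [] := height_mono U eS' fS' lt.
  by rewrite S2 in eS' fS' lt U; have [] := height_mono U eS' fS' lt.
case: (ltngtP (index e (St k.+1)) (index f (St k.+1))) => [/key|/key|E].
- by case=> // -> ->.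
- by case=> // -> ->; rewrite orbT.
by case/eqP: nef; rewrite -(nth_index e eS) E nth_index.
Qed.

Notation point := 'rV[R]_2.
Definition pnt (x y : R) : point := \row_(j < 2) (if j == 0 then x else y).

Lemma pnt_x x y : pnt x y 0 0 = x. Proof. by rewrite mxE. Qed.
Lemma pnt_y x y : pnt x y 0 1 = y. Proof. by rewrite mxE. Qed.

Lemma pnt_comb t x y x' y' : (1 - t) *: pnt x y + t *: pnt x' y' =
  pnt ((1 - t) * x + t * x') ((1 - t) * y + t * y').
Proof. by apply/rowP => j; rewrite !mxE; case: (j == 0). Qed.

Let P (k : nat) (y : nat) : point := pnt k%:R y%:R.

Definition mono_arc e : point * seq point :=
  (P e.1 (h e.1 e), [seq P k (h k e) | k <- iota e.1.+1 (e.2 - e.1)]).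

Lemma mono_arc_nth e i : (i <= e.2 - e.1)%N ->
  nth 0 ((mono_arc e).1 :: (mono_arc e).2) i = P (e.1 + i) (h (e.1 + i) e).
Proof.
case: i => [|i] ie /=; first by rewrite addn0.
by rewrite (nth_map 0%N) ?size_iota // nth_iota // addSnnS.
Qed.

(** Requiring [t < 1] makes [k] and [t] functions of the abscissa, so points of two arcs can be
    compared; the right end of the arc is the case [k = e.2], [t = 0]. *)
Lemma mono_on_arc e x : (e.1 < e.2)%N -> on_polyline (mono_arc e).1 (mono_arc e).2 x ->
  exists k t, [/\ 0 <= t < 1, (e.1 <= k)%N, (k < e.2)%N || (k == e.2) && (t == 0) &
    x = pnt (k%:R + t) ((1 - t) * (h k e)%:R + t * (h k.+1 e)%:R)].
Proof.
move=> e12 /on_polylineP; rewrite size_map size_iota subn_gt0 => /(_ e12)[i ie].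
rewrite !mono_arc_nth ?(ltnW ie) // => -[t [/andP[t0 t1] ->]].
have ie2 : (e.1 + i < e.2)%N by rewrite -ltn_subRL.
rewrite leNgt in t1; have [t1'|] := ltP t 1.
  exists (e.1 + i)%N, t; rewrite t0 t1' leq_addr ie2; split=> //.
  by rewrite pnt_comb addnS; congr pnt; rewrite -natr1; ring.
rewrite le_eqVlt (negbTE t1) orbF => /eqP <-; exists (e.1 + i.+1)%N, 0.
split; [by rewrite lexx ltr01 | exact: leq_addr | |].
  by rewrite eqxx andbT orbC -leq_eqVlt addnS.
by rewrite pnt_comb addnS; congr pnt; ring.
Qed.

Lemma iota_arc_right (f : nat -> nat) m l x :
  on_polyline (P m (f m)) [seq P k (f k) | k <- iota m.+1 l] x -> m%:R <= x 0 0.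
Proof.
elim: l m => [|l IH] m /=; first by move=> ->; rewrite pnt_x.
case=> [[t [/andP[t0 t1] ->]]|/IH]; last by apply: le_trans; rewrite ler_nat.
by rewrite pnt_comb pnt_x -natr1; lra.
Qed.

Lemma simple_iota_arc (f : nat -> nat) m l :
  simple_polyline (P m (f m)) [seq P k (f k) | k <- iota m.+1 l].
Proof.
elim: l m => [//|l IH] m; split; last exact: IH.
  apply/eqP => /(congr1 (fun p : point => p 0 0)); rewrite !pnt_x => /eqP.
  by rewrite eqr_nat ltn_eqF.
move=> x [t [/andP[t0 t1] ->]] /iota_arc_right.
rewrite pnt_comb pnt_x -natr1 => ge; have -> : t = 1 by lra.
by rewrite /P -?natr1; congr pnt; ring.
Qed.

Variable G : sgraph 'I_n.
Hypothesis GD : forall e, e \in edges G ->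
  exists u v : 'I_n, e = [set u; v] /\ (u : nat, v : nat) \in D.

Lemma sweep_drawing : planar R G.
Proof.
have [f fP] : exists f : {set 'I_n} -> nat * nat, forall e, e \in edges G ->
    exists u v : 'I_n, [/\ e = [set u; v], f e \in D & f e = (u : nat, v : nat)].
  have H e : exists p : nat * nat, e \in edges G ->
      exists u v : 'I_n, [/\ e = [set u; v], p \in D & p = (u : nat, v : nat)].
    case: (boolP (e \in edges G)) => [/GD[u [v [-> uvD]]]|_]; last by exists (0%N, 0%N).
    by exists (u : nat, v : nat) => _; exists u, v.
  by have [f fP] := boolp.choice H; exists f.
have fE e : e \in edges G -> f e \in D by move/fP => [u [v []]].
have f12 e : e \in edges G -> ((f e).1 < (f e).2)%N.
  by move/fE/born_lt => /andP[].
have fn e : e \in edges G -> ((f e).2 < n)%N by move/fE/born_lt => /andP[].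
have fin e (w : 'I_n) : e \in edges G ->
  (w \in e) = ((w : nat) == (f e).1) || ((w : nat) == (f e).2).
  by move/fP => [u [v [-> _ ->]]]; rewrite !inE.
have nat_frac (k k' : nat) (t t' : R) : 0 <= t < 1 -> 0 <= t' < 1 ->
    k%:R + t = k'%:R + t' -> k = k' /\ t = t'.
  move=> /andP[t0 t1] /andP[t0' t1'] E; suff kk : k = k'.
    by split=> //; move: E; rewrite kk => /addrI.
  by case: (ltngtP k k') => // lt; move: lt; rewrite -(ler_nat R) -natr1 => lt; exfalso;
    lra.
exists (fun w : 'I_n => P w (size (X w))), (fun e => mono_arc (f e)); split.
- move=> u v /(congr1 (fun p : point => p 0 0)); rewrite !pnt_x => /eqP.
  by rewrite eqr_nat => /eqP/val_inj.
- by move=> e eE; apply: (simple_iota_arc (fun k => h k (f e))).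
- move=> e eE; have [u [v [euv fD fuv]]] := fP e eE; exists u, v; split=> //.
    by rewrite /mono_arc /= fuv /= (height_end (e := (_, _))) //; left.
  have := f12 e eE; rewrite (last_nth 0) {1 2}/mono_arc /= fuv /= size_map size_iota =>
    uv.
  have := @mono_arc_nth (u : nat, v : nat) (v - u) (leqnn _).
  by rewrite /mono_arc /= => ->; rewrite subnKC ?(ltnW uv) // (height_end (e := (_,
    _))) //; right.
- move=> e w eE /(mono_on_arc (f12 e eE)) [k [t [t01 ek ke xE]]].
  have /(congr1 (fun p : point => p 0 0)) := xE;
    have /(congr1 (fun p : point => p 0 1)) := xE.
  rewrite !pnt_x !pnt_y => yE; rewrite -[X in X = _]addr0 => /nat_frac[||wk t0] //.
    by rewrite lexx ltr01.
  subst k; rewrite -t0 subr0 mul1r mul0r addr0 in yE.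
  have {}yE : size (X w) = h w (f e) by apply/eqP; rewrite -(eqr_nat R) yE.
  rewrite fin //; apply: contraT; rewrite negb_or => /andP[n1 n2].
  have : f e \in X w ++ Y w.
    apply: XY_mem; [exact: fE | rewrite !ltn_neqAle eq_sym n1 ek n2 /=].
    by case/orP: ke => [/ltnW //|/andP[/eqP->]].
  rewrite mem_cat; move: yE; rewrite /h /height -index_mem.
  case: ifP => [lt yE|_ yE]; first by rewrite -yE ltnn in lt.
  by case: ifP yE => // _ /eqP; rewrite -addn1 -addnA -[X in X == _]addn0 eqn_add2l.
move=> e e' eE eE' nee x /(mono_on_arc (f12 e eE)) [k [t [t01 ek ke ->]]].
move=> /(mono_on_arc (f12 e' eE')) [k' [t' [t01' ek' ke' xE]]].
have /(congr1 (fun p : point => p 0 0)) := xE;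
  have /(congr1 (fun p : point => p 0 1)) := xE.
rewrite !pnt_x !pnt_y => yE /nat_frac[||kk tt] //; subst k' t'; rewrite {xE}.
have nff : f e != f e'.
  apply: contra nee => /eqP ff; have [u [v [eu _ fu]]] := fP e eE.
  have [u' [v' [eu' _ fu']]] := fP e' eE'; move: ff; rewrite fu fu' => -[uu vv].
  by rewrite eu eu' (val_inj uu) (val_inj vv).
have [t0|tn0] := eqVneq t 0.
  subst t; have kn : (k < n)%N.
    case/orP: ke => [/ltn_trans|/andP[/eqP-> _]]; [apply|]; exact: fn.
  move: yE; rewrite !subr0 !mul1r !mul0r !addr0 => /eqP; rewrite eqr_nat => /eqP hE.
  have uXY : uniq (X k ++ Y k).
    have := St_uniq (ltnW kn); have [-> _] := StE kn.
    by rewrite uniq_catCA cat_uniq => /and3P[].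
  have /andP[nX nX'] := height_touch uXY nff hE.
  have key g : g \in edges G -> ((f g).1 <= k)%N ->
    (k < (f g).2)%N || (k == (f g).2) && true ->
      f g \notin X k ++ Y k -> (k == (f g).1) || (k == (f g).2).
    move=> gE gk kg; apply: contraR; rewrite negb_or => /andP[n1 n2].
    apply: XY_mem; first exact: fE.
    rewrite ltn_neqAle eq_sym n1 gk /=; move: kg; rewrite (negbTE n2) orbF //.
  rewrite eqxx in ke ke'.
  exists (Ordinal kn); first by rewrite inE !fin //= !key.
  have eh := height_end (e := f e) (k := k) _ kn; rewrite eh.
    by rewrite /P /=; congr pnt; ring.
  by case/orP: (key e eE ek ke nX) => /eqP; [left|right].
rewrite (negbTE tn0) !andbF !orbF in ke ke'.
case/andP: t01 => t0 t1; have tp : 0 < t by rewrite lt_neqAle eq_sym tn0.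
have kn : (k.+1 < n)%N by apply: leq_ltn_trans ke (fn e eE).
have ek2 : ((f e).1 <= k < (f e).2)%N by rewrite ek.
have ek2' : ((f e').1 <= k < (f e').2)%N by rewrite ek'.
(* For [0 < t < 1], weakly ordered strands that meet inside a slab must meet at both of its ends. *)
have eq2 (a b c d : nat) : (a <= b)%N -> (c <= d)%N ->
    (1 - t) * a%:R + t * c%:R = (1 - t) * b%:R + t * d%:R :> R -> a = b /\ c = d.
  rewrite -(ler_nat R) -(ler_nat R c) => ab cd E.
  by split; apply/eqP; rewrite -(eqr_nat R) eq_le; apply/andP; split=> //; nra.
exfalso; case/orP: (heights_mono (fE e eE) (fE e' eE') kn ek2 ek2') => /andP[h0 h1].
  have [h0' h1'] := eq2 _ _ _ _ h0 h1 yE.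
  exact: (heights_split (fE e eE) (fE e' eE') nff kn ek2 ek2' h0' h1').
have [h0' h1'] := eq2 _ _ _ _ h0 h1 (esym yE).
exact: (heights_split (fE e eE) (fE e' eE') nff kn ek2 ek2' (esym h0') (esym h1')).
Qed.

End SweepDrawing.

Lemma sweep_planar (R : realType) n D (G : sgraph 'I_n) : sweep n [::] D ->
  (forall e, e \in edges G -> exists u v : 'I_n, e = [set u;
    v] /\ (u : nat, v : nat) \in D) ->
  planar R G.
Proof.
move=> /sweep_history[St [X [A [B [Y [S0 Sn HS HC HD]]]]]] GD.
exact: (sweep_drawing R S0 Sn HS HC HD GD).
Qed.

Lemma sweep_born_lt n D : sweep n [::] D -> forall e, e \in D -> (e.1 < e.2 < n)%N.
Proof.
move=> /sweep_history[St [X [A [B [Y [S0 Sn HS HC HD]]]]]] e eD.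
exact: (born_lt Sn HS HC HD eD).
Qed.

Lemma sweep_uniq n L D : sweep n L D -> uniq D.
Proof.
elim=> // k X A B Y {}D sw IH _ _ cB uB; rewrite cat_uniq IH uB andbT.
have [St [X' [A' [B' [Y' [_ _ _ _ HD]]]]]] := sweep_history sw.
apply/hasPn => e /(allP cB)/andP[/eqP ek _]; apply/negP => /HD[].
by rewrite ek ltnn.
Qed.

(** * Cyclic covers of the icosidodecahedron *)

Section Gadget.
Local Open Scope nat_scope.

(* One wedge is half of an icosidodecahedron with a centre in each triangle: its
   24 vertices other than the poles N and S are numbered from left to right.
   Relatively to a wedge, code 0 stands for N and 73 for S; 1 + c, 25 + c and
   49 + c stand for vertex c of the previous, the current and the next wedge; and
   74 + c for vertex c of the last wedge, seen from the first one, or of the first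
   wedge, seen from the last one. The c-th list gives the right ends of the edges
   starting at vertex c, from bottom to top. *)
Definition wedge : seq (seq nat) :=
  [:: [:: 36; 26; 28; 33; 27]; [:: 36; 28]; [:: 33]; [:: 36; 29; 32; 34];
      [:: 42; 37; 30; 34; 32]; [:: 37; 42; 47; 31; 46]; [:: 47; 46]; [:: 34];
      [:: 38; 35]; [:: 43; 40; 38]; [:: 38]; [:: 73; 41; 39]; [:: 42];
      [:: 40; 43]; [:: 41; 73; 48; 45; 42]; [:: 43]; [:: 73]; [:: 45; 48];
      [:: 46; 44]; [:: 46]; [:: 48]; [:: 47]; [:: 57; 59; 62]; [:: 49; 51; 57]].

(* The edges from the last wedge back to the first one start in the first wedge and
   pass above N, which is drawn right after the first wedge. *)
Definition first_wedge : seq (seq nat) :=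
  [seq nth [::] wedge c ++
       [seq 74 + c' | c' <- iota 0 24 & 49 + c \in nth [::] wedge c'] ++
       nseq (c \in [:: 18; 19; 21]) 0 | c <- iota 0 24].

Definition last_wedge : seq (seq nat) :=
  [seq [seq r <- s | ~~ (48 < r < 73)] | s <- wedge].

(** Number 24, right after the first wedge, is reserved for N; S receives the last number,
    [24 * q + 1]. *)
Definition vertex_num k := if k < 24 then k else k.+1.

Definition vertex_of q i r :=
  if r == 0 then 24 else if r == 73 then 24 * q + 1 else
  if r < 73 then vertex_num (24 * i + r - 25)
  else vertex_num (r - 74 + (if i == 0 then 24 * q.-1 else 0)).

Definition edge_of q i (e : nat * nat) := (vertex_of q i e.1, vertex_of q i e.2).

(** The last conjunct keeps [vertex_of] injective on [ts]: for [q = 2] the next wedge of the first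
    one is also the last one, and in the last wedge code 49 would receive the number of S. *)
Definition next_codes (i0 : bool) v ts :=
  [&& all (fun r => (v < r < (if i0 then 98 else 74)) || i0 && (r == 0)) ts, uniq ts &
      ~~ (has (fun r => 48 < r < 73) ts && has (fun r => 72 < r) ts)].

(** The sweep is run on codes, so that one computation serves every [q] and every inner wedge. The
    range test on the remaining strands lets [vertex_of_neq] transfer it to vertices. *)
Fixpoint run_block i0 v (L : seq (nat * nat)) (t : seq (seq nat)) :
    option (seq (nat * nat)) :=
  if t is ts :: t' then
    let p := find (fun e => e.2 == v) L in
    let r := drop p L in
    let y := drop (find (fun e => e.2 != v) r) r in
    if all (fun e => (e.2 != v) && (24 < e.2 < 98) || (e.2 == 0)) (take p L ++ y) &&
      next_codes i0 v ts
    then run_block i0 v.+1 (take p L ++ [seq (v, r) | r <- ts] ++ y) t' else None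
  else Some L.

Fixpoint block_edges v (t : seq (seq nat)) : seq (nat * nat) :=
  if t is ts :: t' then [seq (v, r) | r <- ts] ++ block_edges v.+1 t' else [::].

Lemma vertex_of_current q i v : 24 < v < 49 ->
  vertex_of q i v = vertex_of q i 25 + (v - 25).
Proof. by rewrite /vertex_of /vertex_num; move=> h; do !case: ifP; lia. Qed.

Lemma vertex_of_neq q i v r : 1 < q -> i < q -> 24 < v < 49 -> 24 < r < 98 \/ r = 0 ->
  r != v ->
  vertex_of q i r != vertex_of q i v.
Proof. rewrite /vertex_of /vertex_num; move=> h1 h2 h3 h4 h5; do !case: ifP; lia. Qed.

Lemma vertex_of_lt q i v r : 1 < q -> i < q -> 24 < v < 49 ->
  (v < r < (if i == 0 then 98 else 74)) || (i == 0) && (r == 0) ->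
    vertex_of q i v < vertex_of q i r.
Proof. rewrite /vertex_of /vertex_num; move=> h1 h2 h3; do !case: ifP; lia. Qed.

Lemma vertex_of_inj q i r r' : 1 < q -> i < q ->
  (24 < r < (if i == 0 then 98 else 74)) || (i == 0) && (r == 0) ->
  (24 < r' < (if i == 0 then 98 else 74)) || (i == 0) && (r' == 0) ->
  ~~ (48 < r < 73) || ~~ (72 < r') -> ~~ (48 < r' < 73) || ~~ (72 < r) ->
  vertex_of q i r = vertex_of q i r' -> r = r'.
Proof. rewrite /vertex_of /vertex_num; move=> h1 h2; do !case: ifP; lia. Qed.

Definition sink_strands : seq (nat * nat) := [:: (36, 73); (41, 73); (39, 73)].
Definition source_strands : seq (nat * nat) := [:: (0, 43); (0, 44); (0, 46)].
Definition cut_strands : seq (nat * nat) := [:: (24, 25); (24, 27); (24, 33); (23, 33);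
  (23, 35); (23, 38)].
Definition next_cut_strands := [seq (e.1 + 24, e.2 + 24) | e <- cut_strands].
Definition far_strands : seq (nat * nat) := [:: (38, 96); (35, 96); (33, 96); (33, 97);
  (27, 97); (25, 97)].
(** The shift [49 = 74 - 25] turns codes seen from the first wedge into codes seen from the last
    one. *)
Definition far_strands_end := [seq (e.1 + 49, e.2 - 49) | e <- far_strands].

Lemma run_first : run_block true 25 [::] first_wedge =
  Some (sink_strands ++ next_cut_strands ++ [:: (46, 0); (44, 0);
    (43, 0)] ++ far_strands).
Proof. by vm_compute. Qed.

Lemma run_wedge : run_block false 25 (cut_strands ++ source_strands) wedge = Some
  (sink_strands ++ next_cut_strands).
Proof. by vm_compute. Qed.

Lemma run_last : run_block false 25 (cut_strands ++ source_strands ++ far_strands_end)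
  last_wedge = Some sink_strands.
Proof. by vm_compute. Qed.

Lemma all_take_find_pred (T : Type) (p : pred T) s : all (predC p) (take (find p s) s).
Proof. by elim: s => //= x s IH; case: ifP => //= ->. Qed.

Lemma run_sweep q i P Q D t v L L' : 1 < q -> i < q -> 25 <= v -> v + size t <= 49 ->
  (forall e c, e \in P ++ Q -> 24 < c < 49 -> e.2 != vertex_of q i c) ->
  run_block (i == 0) v L t = Some L' ->
  sweep (vertex_of q i 25 + (v - 25)) (P ++ map (edge_of q i) L ++ Q) D ->
  sweep (vertex_of q i 25 + (v - 25) + size t) (P ++ map (edge_of q i) L' ++ Q)
    (D ++ map (edge_of q i) (block_edges v t)).
Proof.
move=> q1 iq v25 vt PQ; elim: t v v25 vt L D => [|ts t IH] v v25 /= vt L D.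
  by case=> <-; rewrite addn0 cats0.
set p := find _ L; set r := drop p L; set y := drop _ r.
case: ifP => // /andP[/allP cxy /and3P[/allP ct uts compat]] /IH run_t sw.
have v49 : 24 < v < 49 by lia.
rewrite -addSnnS [map _ (_ ++ block_edges _ _)]map_cat [D ++ _]catA.
have -> : (vertex_of q i 25 + (v - 25)).+1 = vertex_of q i 25 + (v.+1 - 25) by lia.
apply: run_t; [by lia | by lia |].
have -> : vertex_of q i 25 + (v.+1 - 25) = (vertex_of q i 25 + (v - 25)).+1 by lia.
rewrite -(vertex_of_current q i v49) in sw *.
pose a := take (find (fun e => e.2 != v) r) r.
have LE : L = take p L ++ a ++ y by rewrite !cat_take_drop.
have {}sw : sweep (vertex_of q i v) ((P ++ map (edge_of q i) (take p L)) ++ map (edge_of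
  q i) a ++
    (map (edge_of q i) y ++ Q)) D.
  by move: sw; rewrite {1}LE !map_cat -!catA.
rewrite !map_cat -catA -catA (catA P).
have cond e : e \in take p L ++ y -> vertex_of q i e.2 != vertex_of q i v.
  move=> /cxy /orP[/andP[nv e2]|/eqP e0]; apply: vertex_of_neq => //; [by left|by right|].
  by rewrite e0; move: v49; clear; case: v.
apply: (sweep_step sw).
- rewrite all_map; apply/allP => e /= ea; rewrite /edge_of /=.
  by have /allP/(_ e ea)/negPn/eqP -> := all_take_find_pred (fun e => e.2 != v) r.
- apply/allP => e; rewrite !mem_cat -!orbA.
  case/or4P=> [eP|/mapP[e' e'x ->]|/mapP[e' e'y ->]|eQ].
  + by apply: PQ => //; rewrite mem_cat eP.
  + by apply: cond; rewrite mem_cat e'x.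
  + by apply: cond; rewrite mem_cat e'y orbT.
  + by apply: PQ => //; rewrite mem_cat eQ orbT.
- rewrite !all_map; apply/allP => r' /ct /= h; rewrite eqxx /=.
  by apply: vertex_of_lt.
- have wide (r' : nat) : r' \in ts ->
      (24 < r' < (if i == 0 then 98 else 74)) || (i == 0) && (r' == 0).
    move=> /ct /orP[/andP[vr ->]|->]; last by rewrite orbT.
    by rewrite (leq_trans _ vr) // ltnS ltnW //; case/andP: v49.
  rewrite -map_comp map_inj_in_uniq // => r1 r2 r1t r2t /= [rr];
    apply: (@vertex_of_inj q i) => //.
  + by have := wide r1 r1t.
  + by have := wide r2 r2t.
  + rewrite -negb_and; apply: contra compat => /andP[h1 h2].
    by apply/andP; split; apply/hasP; [exists r1 | exists r2].
  + rewrite -negb_and; apply: contra compat => /andP[h1 h2].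
    by apply/andP; split; apply/hasP; [exists r2 | exists r1].
Qed.

Definition sinks q i := flatten [seq map (edge_of q j) sink_strands | j <- iota 0 i].
Definition sources q i := flatten [seq map (edge_of q j) source_strands | j <- iota i (q
  - i)].
Definition far_edges q := map (edge_of q 0) far_strands.
(** The cut before wedge [i], from bottom to top: strands collected for S, strands from the previous
    wedge, strands from N to the wedges still to come, and on top those joining the first wedge to
    the last. A block thus changes only a middle portion. *)
Definition front q i := sinks q i ++ map (edge_of q i) cut_strands ++ sources q i ++
  far_edges q.

Definition gadget q : seq (nat * nat) :=
  (map (edge_of q 0) (block_edges 25 first_wedge) ++ sources q 1) ++
  flatten [seq map (edge_of q i) (block_edges 25 wedge) | i <- iota 1 (q - 2)] ++
  map (edge_of q q.-1) (block_edges 25 last_wedge).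

Lemma sinks_target q i e : e \in sinks q i -> e.2 = 24 * q + 1.
Proof. by case/flatten_mapP=> j _ /mapP[e' + ->] /=; rewrite !inE => /or3P[] /eqP ->. Qed.

Lemma sources_bounds q i e : 0 < i -> e \in sources q i ->
  e.1 = 24 /\ 24 * i + 18 < e.2 < 24 * q + 1.
Proof.
move=> i0 /flatten_mapP[j + /mapP[e' + ->]] /=; rewrite mem_iota !inE => /andP[ij jq].
by rewrite /vertex_of /vertex_num => /or3P[] /eqP -> /=; split=> //; case: ifP; lia.
Qed.

Lemma wraps_gt q e : 1 < q -> e \in far_edges q -> 24 * q.-1 + 22 < e.2.
Proof.
move=> q1 /mapP[e' + ->]; rewrite !inE /edge_of /vertex_of /vertex_num =>
  /or4P[|||/or3P[]] /eqP -> /=;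
  by case: ifP; lia.
Qed.

Lemma vertex_of_le q i c : 24 < c < 49 -> vertex_of q i c <= 24 * i + 24.
Proof. by rewrite /vertex_of /vertex_num => h; do !case: ifP; lia. Qed.

Lemma vertex_of_shift q i r : 0 < r < 49 -> vertex_of q i (r + 24) = vertex_of q i.+1 r.
Proof. by rewrite /vertex_of /vertex_num => h; do !case: ifP; lia. Qed.

Lemma vertex_of_gt24 q i r : 0 < i -> 24 < r < 73 -> 24 < vertex_of q i r.
Proof. by rewrite /vertex_of /vertex_num => h h'; do !case: ifP; lia. Qed.

Lemma next_cut_strandsE q i : map (edge_of q i) next_cut_strands = map (edge_of q i.+1)
  cut_strands.
Proof.
rewrite /next_cut_strands -map_comp; apply/eq_in_map => e ecut.
have /andP[h1 h2] : (0 < e.1 < 49) && (0 < e.2 < 49) by move: e ecut; apply/allP.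
by rewrite /edge_of /= !vertex_of_shift.
Qed.

Lemma far_edges_last q : 1 < q -> far_edges q = map (edge_of q q.-1) far_strands_end.
Proof.
case: q => [|[|q]] // _; rewrite /far_edges /far_strands_end -map_comp /= /edge_of
  /vertex_of /vertex_num /=.
by repeat (congr (_ :: _); first by congr pair; rewrite ?ltnn; repeat case: ifP; lia).
Qed.

Lemma sinksS q i : sinks q i.+1 = sinks q i ++ map (edge_of q i) sink_strands.
Proof. by rewrite /sinks -addn1 iotaD map_cat flatten_cat. Qed.

Lemma sourcesS q i : i < q -> sources q i = map (edge_of q i) source_strands ++ sources
  q i.+1.
Proof. by move=> iq; rewrite /sources -(subnSK iq). Qed.

Lemma sources_uniq q i : 0 < i -> uniq (sources q i).
Proof.
move=> i0; rewrite /sources; move: (q - i) => m; elim: m i i0 => [|m IH] i i0 //.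
have U := IH i.+1 isT.
have out e : e \in flatten [seq map (edge_of q j) source_strands | j <- iota i.+1 m] ->
  24 * i + 24 < e.2.
  case/flatten_mapP=> j + /mapP[e' + ->]; rewrite mem_iota !inE /= => /andP[ij _].
  by rewrite /vertex_of /vertex_num => /or3P[] /eqP -> /=; case: ifP; lia.
have evc c : 24 < c < 49 -> vertex_of q i c = 24 * i + c - 24.
  by rewrite /vertex_of /vertex_num => h; do !case: ifP; lia.
rewrite [flatten _](_ : _ = [:: (24, vertex_of q i 43); (24, vertex_of q i 44);
  (24, vertex_of q i 46)] ++
  flatten [seq map (edge_of q j) source_strands | j <- iota i.+1 m]) //.
rewrite cat_uniq U andbT !evc //; apply/andP; split.
  by rewrite /= !inE !xpair_eqE !eqxx /=; apply/and3P; split; lia.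
apply/hasPn => e /out; rewrite !inE => lt; apply/negP => /or3P[] /eqP eE; move: lt;
  by rewrite eE /=; lia.
Qed.

Lemma sweep_block q i P Q D t L L' : 1 < q -> i < q -> size t = 24 ->
  (forall e c, e \in P ++ Q -> 24 < c < 49 -> e.2 != vertex_of q i c) ->
  run_block (i == 0) 25 L t = Some L' ->
  sweep (vertex_of q i 25) (P ++ map (edge_of q i) L ++ Q) D ->
  sweep (vertex_of q i 25 + 24) (P ++ map (edge_of q i) L' ++ Q) (D ++ map (edge_of q i)
    (block_edges 25 t)).
Proof.
move=> q1 iq t24 PQ Lr sw; have := @run_sweep q i P Q D t 25 L L' q1 iq isT.
by rewrite t24 subnn addn0; apply.
Qed.

Lemma size_wedges : [/\ size first_wedge = 24, size wedge = 24 & size last_wedge = 24].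
Proof. by []. Qed.

Opaque first_wedge wedge last_wedge block_edges.

Lemma sweep_first q : 1 < q ->
  sweep 25 (front q 1) (map (edge_of q 0) (block_edges 25 first_wedge) ++ sources q 1).
Proof.
move=> q1; have q0 : 0 < q by apply: ltnW.
have none (e : nat * nat) c : e \in [::] ++ [::] -> 24 < c < 49 ->
  e.2 != vertex_of q 0 c by [].
have [t24 _ _] := size_wedges.
have := sweep_block q1 q0 t24 none run_first sweep_nil.
set D := map _ (block_edges _ _); rewrite [[::] ++ D]cat0s.
rewrite cats0 !map_cat -/(far_edges q) next_cut_strandsE (_ : vertex_of q 0 25 + 24 =
  24) // => sw.
have -> : front q 1 = (sinks q 1 ++ map (edge_of q 1) cut_strands) ++ sources q 1 ++
  far_edges q.
  by rewrite /front !catA.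
(* This vertex is N: it closes its three edges from the first wedge and opens those to all other
   wedges. *)
apply: (sweep_step (A := map (edge_of q 0) [:: (46, 0); (44, 0); (43, 0)])).
- by move: sw; rewrite -!catA.
- by [].
- apply/allP => e; rewrite [e \in _ ++ far_edges q]mem_cat [e \in sinks q 1 ++ _]mem_cat
  -orbA.
  case/or3P=> [/sinks_target e2|/mapP[e' e'c ->]|/(wraps_gt q1)].
  + by rewrite e2; lia.
  + have h : 24 < e'.2 < 73 by move: e' e'c; apply/allP.
    by rewrite neq_ltn /= vertex_of_gt24 ?orbT.
  + by move=> lt; rewrite neq_ltn (leq_ltn_trans _ lt) ?orbT //; lia.
- by apply/allP => e /(sources_bounds (ltn0Sn 0))[-> /andP[h _]];
  rewrite eqxx (leq_ltn_trans _ h).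
- exact: sources_uniq.
Qed.

Lemma sweep_wedge q i D : 0 < i -> i.+1 < q -> sweep (24 * i + 1) (front q i) D ->
  sweep (24 * i.+1 + 1) (front q i.+1) (D ++ map (edge_of q i) (block_edges 25 wedge)).
Proof.
move=> i0 iq sw; have q1 : 1 < q by lia.
have iq' : i < q := ltnW iq.
have E25 : vertex_of q i 25 = 24 * i + 1 by rewrite /vertex_of /vertex_num;
  do !case: ifP; lia.
have iE : (i == 0) = false by case: (i) i0.
have PQ (e : nat * nat) c : e \in sinks q i ++ (sources q i.+1 ++ far_edges q) ->
  24 < c < 49 ->
    e.2 != vertex_of q i c.
  move=> H hc; have le := vertex_of_le q i hc; move: H.
  rewrite [e \in sinks q i ++ _]mem_cat [e \in _ ++ far_edges q]mem_cat.
  move=> H; suff lt : vertex_of q i c < e.2 by rewrite neq_ltn lt orbT.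
  apply: leq_ltn_trans le _.
  case/or3P: H => [/sinks_target ->|/(sources_bounds (ltn0Sn i))[_ /andP[lt
    _]]|/(wraps_gt q1) lt].
  - by lia.
  - by apply: leq_ltn_trans lt; lia.
  - by apply: leq_ltn_trans lt; lia.
have [_ t24 _] := size_wedges.
have := sweep_block (D := D) (L := cut_strands ++ source_strands) q1 iq' t24 PQ.
rewrite iE => /(_ _ run_wedge); rewrite E25 => step.
rewrite /front sourcesS // in sw.
have E1 : map (edge_of q i) (sink_strands ++ next_cut_strands) = map (edge_of q i)
  sink_strands ++ map (edge_of q i.+1) cut_strands.
  by rewrite map_cat next_cut_strandsE.
have E2 : map (edge_of q i) (cut_strands ++ source_strands) = map (edge_of q i)
  cut_strands ++ map (edge_of q i) source_strands by rewrite map_cat.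
rewrite E1 E2 -!catA in step; rewrite -!catA in sw.
rewrite (_ : 24 * i.+1 + 1 = 24 * i + 1 + 24); last by lia.
by rewrite /front sinksS -!catA; apply: step.
Qed.

Lemma sweep_last q D : 1 < q -> sweep (24 * q.-1 + 1) (front q q.-1) D ->
  sweep (24 * q + 2) [::] (D ++ map (edge_of q q.-1) (block_edges 25 last_wedge)).
Proof.
case: q => // q q1 /= sw.
have E25 : vertex_of q.+1 q 25 = 24 * q + 1 by rewrite /vertex_of /vertex_num;
  do !case: ifP; lia.
have iE : (q == 0) = false by case: (q) q1.
have PQ (e : nat * nat) c : e \in sinks q.+1 q ++ [::] -> 24 < c < 49 ->
  e.2 != vertex_of q.+1 q c.
  by rewrite cats0 => /sinks_target -> hc; have := vertex_of_le q.+1 q hc; lia.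
have [_ _ t24] := size_wedges.
have := sweep_block (D := D) (L := cut_strands ++ source_strands ++ far_strands_end) q1
  (ltnSn q) t24 PQ.
rewrite iE => /(_ _ run_last); rewrite E25 => step.
move: sw; rewrite /front sourcesS // far_edges_last // [sources _ q.+1](_ : _ = [::]);
  last first.
  by rewrite /sources subnn.
have E2 : map (edge_of q.+1 q) (cut_strands ++ source_strands ++ far_strands_end) =
  map (edge_of q.+1 q) cut_strands ++ map (edge_of q.+1 q) source_strands ++ map
    (edge_of q.+1 q) far_strands_end by rewrite !map_cat.
rewrite E2 !cats0 -sinksS in step * => sw; have {sw step} sw := step sw.
have -> : 24 * q.+1 + 2 = (24 * q + 1 + 24).+1 by lia.
(* The final vertex is S, where all remaining strands end. *)
rewrite -[D ++ _]cats0; apply: (@sweep_step _ [::] (sinks q.+1 q.+1) [::] [::]) => //.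
  by rewrite cats0.
by apply/allP => e /sinks_target ->; apply/eqP; lia.
Qed.

Lemma sweep_gadget q : 1 < q -> sweep (24 * q + 2) [::] (gadget q).
Proof.
move=> q1; rewrite /gadget catA; apply: sweep_last => //.
have -> : q.-1 = (q - 2).+1 by lia.
have : (q - 2).+1 < q by lia.
elim: (q - 2) => [|m IH] mq; first by rewrite /= cats0; apply: sweep_first.
have -> : iota 1 m.+1 = iota 1 m ++ [:: m.+1] by rewrite -{1}(addn1 m) iotaD.
rewrite map_cat flatten_cat catA; rewrite [flatten [seq _ | i <- [:: m.+1]]]cats0.
by apply: sweep_wedge => //; apply: IH; apply: ltnW.
Qed.

(** An inner wedge starts 57 edges. The first wedge starts six more to the last wedge and three more
    to N, the last wedge six fewer, and N starts three for each wedge after the first. *)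
Lemma size_gadget q : 1 < q -> size (gadget q) = 60 * q.
Proof.
move=> q1; have sz t : size (block_edges 25 t) = sumn (map size t).
  by elim: t 25 => //= s t IH v; rewrite size_cat size_map IH.
have [e1 e2 e3] : [/\ size (block_edges 25 first_wedge) = 66,
  size (block_edges 25 wedge) = 57 &
  size (block_edges 25 last_wedge) = 51] by rewrite !sz.
have flat (s : seq (nat * nat)) i m :
    size (flatten [seq map (edge_of q j) s | j <- iota i m]) = size s * m.
  elim: m i => [|m IH] i; first by rewrite muln0.
  by rewrite [iota _ _]/= map_cons [flatten _]/= size_cat IH size_map mulnS.
by rewrite /gadget !size_cat /sources !flat !size_map e1 e2 e3 [size source_strands]/=;
  lia.
Qed.

(* If vertex c of a wedge has index k in its periodic sequence of wedges, then the
   right ends of the edges starting at c have indices k + d - 48. *)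
Definition forward_diffs c := [seq r + 23 - c | r <- nth [::] wedge c & r < 73].
Definition backward_diffs c :=
  [seq 96 - d | d <- flatten
    [seq [seq d <- forward_diffs c' | (c' + d) %% 24 == c] | c' <- iota 0 24]].
Definition diffs c := forward_diffs c ++ backward_diffs c.
Definition poleN c := c \in [:: 18; 19; 21].
Definition poleS c := c \in [:: 11; 14; 16].

Definition strip_index u := if u < 24 then u else u.-1.

Definition pole q u := (u == 24) || (u == 24 * q + 1).

Definition link q u v := exists2 d,
  d \in forward_diffs (strip_index u %% 24) & strip_index v + 48 = strip_index u + d
  %[mod 24 * q].

(** Edges point to the larger number: N, placed after the first wedge, occurs at both ends, S only
    as a target. Links go both ways because those closing the band run from the first wedge to the
    last. *)
Definition arrow q u v : Prop :=
  [\/ [/\ ~~ pole q u, ~~ pole q v & link q u v \/ link q v u],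
      [/\ ~~ pole q u, v = 24 & poleN (strip_index u %% 24)],
      [/\ u = 24, ~~ pole q v & poleN (strip_index v %% 24)] |
      [/\ ~~ pole q u, v = 24 * q + 1 & poleS (strip_index u %% 24)]].

Lemma strip_index_of q i r : 1 < q -> i < q -> 24 < r < 73 -> (i.+1 < q) || (r < 49) ->
  strip_index (vertex_of q i r) = 24 * i + r - 25 /\ ~~ pole q (vertex_of q i r).
Proof. by rewrite /strip_index /pole /vertex_of /vertex_num => h1 h2 h3 h4; split;
  do !case: ifP; lia. Qed.

Lemma strip_index_far q r : 1 < q -> 73 < r < 98 ->
  strip_index (vertex_of q 0 r) = 24 * q.-1 + r - 74 /\ ~~ pole q (vertex_of q 0 r).
Proof. by rewrite /strip_index /pole /vertex_of /vertex_num eqxx => h1 h2; split;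
  do !case: ifP; lia. Qed.

(** The last case reads a closing edge backwards, from vertex [e.2 - 74] of the last wedge to code
    [49 + (e.1 - 25)] of its successor; adding 23 and subtracting [e.2 - 74] gives the constant
    121. *)
Definition birth_ok (e : nat * nat) :=
  (24 < e.1 < 49) &&
  [|| (e.2 == 0) && poleN (e.1 - 25), (e.2 == 73) && poleS (e.1 - 25),
      (24 < e.2 < 73) && (e.2 + 48 - e.1 \in forward_diffs (e.1 - 25)) |
      (73 < e.2 < 98) && (e.1 + 121 - e.2 \in forward_diffs (e.2 - 74))].

Lemma birth_arrow q i a r : 1 < q -> i < q -> (i == 0) || (r < 74) ->
  (i.+1 < q) || (r < 49) || (r == 73) ->
  birth_ok (a, r) -> arrow q (vertex_of q i a) (vertex_of q i r).
Proof.
move=> q1 iq i0 iq1 /andP[/= ha hr].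
have ha' : 24 < a < 73 by lia.
have [|ia pa] := strip_index_of q1 iq ha'; first by case/andP: ha => _ ->; rewrite orbT.
have ca : strip_index (vertex_of q i a) %% 24 = a - 25 by rewrite ia; lia.
case/or4P: hr => /andP[].
- by move=> /eqP -> pn; constructor 2; rewrite ca.
- by move=> /eqP -> pn; constructor 4; rewrite ca.
- move=> hr hd; have [|ir pr] := strip_index_of q1 iq hr; first by move: iq1 hr; clear;
  lia.
  constructor 1; split=> //; left; exists (r + 48 - a); rewrite ?ca //.
  by rewrite ia ir; congr (_ %% _); lia.
move=> hr hd; have i00 : i = 0 by lia.
subst i; have [ir pr] := strip_index_far q1 hr.
have cr : strip_index (vertex_of q 0 r) %% 24 = r - 74 by rewrite ir; lia.
constructor 1; split=> //; right; exists (a + 121 - r); rewrite ?cr //.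
rewrite ia ir (_ : 24 * q.-1 + r - 74 + (a + 121 - r) = 24 * q + (24 * 0 + a - 25 +
  48)); last by lia.
by rewrite modnDl.
Qed.

Lemma births_ok : all birth_ok (block_edges 25 first_wedge) && all (fun e =>
  birth_ok e && (e.2 < 74)) (block_edges 25 wedge)
  && all (fun e => birth_ok e && ((e.2 < 49) || (e.2 == 73))) (block_edges 25 last_wedge).
Proof. by vm_compute. Qed.

Lemma gadget_arrow q u v : 1 < q -> (u, v) \in gadget q -> arrow q u v.
Proof.
move=> q1; have /andP[/andP[/allP ok1 /allP ok2] /allP ok3] := births_ok.
rewrite /gadget [_ \in _ ++ (_ ++ _)]mem_cat [_ \in _ ++ sources q 1]mem_cat [_ \in
  flatten _ ++ _]mem_cat.
case/orP=> [/orP[|]|/orP[|]].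
- case/mapP=> -[a r] /ok1 ok [-> ->]; apply: birth_arrow => //; first by rewrite ltnW.
  by rewrite q1.
- case/flatten_mapP=> j; rewrite mem_iota => /andP[j1 jq] /mapP[[a r] + [-> ->]].
  have jq' : j < q by lia.
  rewrite !inE !xpair_eqE => H; constructor 3.
  have [->] : a = 0 /\ [|| r == 43, r == 44 | r == 46].
    by case/or3P: H => /andP[/eqP -> ->]; rewrite ?orbT.
  move=> hr; have [||ir pr] := @strip_index_of q j r q1 jq'.
  + by move: hr; clear; lia.
  + by move: hr; clear; lia.
  split=> //; rewrite ir (_ : (24 * j + r - 25) %% 24 = r - 25).
    by case/or3P: hr => /eqP ->.
  by move: hr; clear; lia.
- case/flatten_mapP=> j; rewrite mem_iota =>
  /andP[j1 jq] /mapP[[a r] /ok2 /andP[ok /= r74] [-> ->]].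
  have jq' : j.+1 < q by lia.
  by apply: birth_arrow => //; rewrite ?(ltnW jq') ?r74 ?orbT ?jq'.
case/mapP=> -[a r] /ok3 /andP[ok /= r49] [-> ->]; apply: birth_arrow => //.
- by lia.
- by move: r49; clear; lia.
- by rewrite -orbA r49 orbT.
Qed.

Definition diff_table := Eval vm_compute in [seq diffs c | c <- iota 0 24].
Definition strip_adj m m' := m' + 48 - m \in nth [::] diff_table (m %% 24).
Definition strip_next m := [seq m + d - 48 | d <- nth [::] diff_table (m %% 24)].

(* A Theta_5 contains at most one pole, and its other vertices contain a path on
   four vertices; [pol] tells which vertices of a wedge are adjacent to that pole. *)
Definition strip_check (x0 x2 x3 x4 : nat) : bool :=
  (uniq [:: x0; x2; x3; x4] && strip_adj x4 x0 ==>
     all (fun x1 => uniq [:: x0; x1; x2; x3; x4] ==> ~~ strip_adj x1 x2)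
       (strip_next x0)) &&
  all (fun pol : pred nat =>
     (uniq [:: x0; x2; x3; x4] && pol (x0 %% 24) && pol (x2 %% 24) ==>
        ~~ strip_adj x4 x0 && ~~ pol (x4 %% 24)) &&
     (uniq [:: x0; x2; x3; x4] && pol (x2 %% 24) && pol (x4 %% 24) ==>
        ~~ strip_adj x0 x3)) [:: poleN; poleS].

(** Periodicity allows a fixed starting wedge. As a multiple of 24, 144 preserves the residue [c],
    and it is large enough for the truncated subtractions to be exact, since a step descends by at
    most 21. *)
Lemma strip_checkT c x2 x3 x4 : c < 24 -> x2 \in strip_next (144 + c) ->
  x3 \in strip_next x2 ->
  x4 \in strip_next x3 -> strip_check (144 + c) x2 x3 x4.
Proof.
have : all (fun c => all (fun x2 => all (fun x3 => all (strip_check (144 + c) x2 x3)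
  (strip_next x3)) (strip_next x2)) (strip_next (144 + c))) (iota 0 24) by vm_compute.
move=> /allP/(_ c) H c24 h2 h3 h4; move: H; rewrite mem_iota => /(_ c24).
by move=> /allP/(_ _ h2)/allP/(_ _ h3)/allP/(_ _ h4).
Qed.

Lemma diff_tableE c : c < 24 -> nth [::] diff_table c = diffs c.
Proof.
move=> h; have -> : diff_table = [seq diffs c | c <- iota 0 24] by vm_compute.
by rewrite (nth_map 0) ?size_iota // nth_iota.
Qed.

Lemma diffs_bounds c d : c < 24 -> d \in diffs c -> 27 <= d <= 69.
Proof.
move=> c24; have : all (fun c => all (fun d =>
  27 <= d <= 69) (diffs c)) (iota 0 24) by vm_compute.
by move=> /allP/(_ c); rewrite mem_iota => /(_ c24)/allP; apply.
Qed.

Lemma fwd_bwd c d : c < 24 -> d \in forward_diffs c ->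
  d <= 96 /\ 96 - d \in diffs ((c + d) %% 24).
Proof.
move=> c24 dc; split.
  have dd : d \in diffs c by rewrite mem_cat dc.
  by have /andP[_ h] := diffs_bounds c24 dd; apply: leq_trans h _.
rewrite mem_cat; apply/orP; right; apply: map_f; apply/flatten_mapP; exists c.
  by rewrite mem_iota.
by rewrite mem_filter dc eqxx.
Qed.

Lemma eq_modD a b c d n : a = b %[mod n] -> c = d %[mod n] -> a + c = b + d %[mod n].
Proof. by move=> ab cd; rewrite -modnDm ab cd modnDm. Qed.

(** * Lifting paths to the universal cover of the band *)

Section Lift.
Variable q : nat.
Hypothesis q7 : 6 < q.
Let q1 : 1 < q. Proof. exact: ltn_trans q7. Qed.

Definition gadj u v := ((u, v) \in gadget q) || ((v, u) \in gadget q).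

Lemma gadj_sym u v : gadj u v = gadj v u.
Proof. by rewrite /gadj orbC. Qed.

Lemma gadj_lt u v : gadj u v -> u < 24 * q + 2.
Proof.
by case/orP=> /(sweep_born_lt (sweep_gadget q1)) /= /andP[]; [apply: ltn_trans | ].
Qed.

Definition near_pole p c := if p == 24 then poleN c else poleS c.

Lemma pole_arrow u v : arrow q u v ->
  (pole q u && ~~ pole q v && near_pole u (strip_index v %% 24)) ||
  (pole q v && ~~ pole q u && near_pole v (strip_index u %% 24)) || (~~ pole q u && ~~
    pole q v).
Proof.
have S24 : (24 * q + 1 == 24) = false by apply/eqP; lia.
rewrite /near_pole; case=> [[-> -> _]|[nu -> pu]|[-> nv pv]|[nu -> pu]].
- by rewrite orbT.
- by rewrite nu eqxx pu /pole eqxx /= orbT.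
- by rewrite nv eqxx pv /pole eqxx.
- by rewrite nu pu S24 /pole eqxx orbT /= !orbT.
Qed.

Lemma gadj_pole u v : pole q u -> gadj u v ->
  ~~ pole q v && near_pole u (strip_index v %% 24).
Proof.
move=> pu /orP[] /(gadget_arrow q1)/pole_arrow; rewrite pu /= ?andbF ?orbF //=.
Qed.

Lemma gadj_link u v : ~~ pole q u -> ~~ pole q v -> gadj u v ->
  exists2 d, d \in diffs (strip_index u %% 24) & strip_index v + 48 = strip_index u + d
    %[mod 24 * q].
Proof.
have main u' v' : link q u' v' ->
  (exists2 d, d \in diffs (strip_index u' %% 24) & strip_index v' + 48 = strip_index u'
    + d %[mod 24 * q]) /\
  (exists2 d, d \in diffs (strip_index v' %% 24) & strip_index u' + 48 = strip_index v'
    + d %[mod 24 * q]).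
  case=> d dd E; split; first by exists d; rewrite // mem_cat dd.
  have c24 : strip_index u' %% 24 < 24 by rewrite ltn_mod.
  have [d96 dB] := fwd_bwd c24 dd; exists (96 - d); last first.
    apply/eqP; rewrite -(eqn_modDr d) -!addnA subnK // [48 + d]addnC addnA -modnDml -E
      modnDml.
    by rewrite -addnA.
  suff -> : strip_index v' %% 24 = (strip_index u' %% 24 + d) %% 24 by [].
  rewrite modnDml; have /(congr1 (fun x => x %% 24)) := E.
  rewrite !modn_dvdm ?dvdn_mulr // => <-.
  by rewrite (_ : 48 = 2 * 24) // addnC modnMDl.
have [S24 pS] : pole q 24 /\ pole q (24 * q + 1) by rewrite /pole !eqxx orbT.
move=> nu nv /orP[] /(gadget_arrow q1) [] [].
- by move=> _ _ [] /main[].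
- by move=> _ vE; rewrite vE S24 in nv.
- by move=> uE; rewrite uE S24 in nu.
- by move=> _ vE; rewrite vE pS in nv.
- by move=> _ _ [] /main[].
- by move=> _ vE; rewrite vE S24 in nu.
- by move=> uE; rewrite uE S24 in nv.
- by move=> _ vE; rewrite vE pS in nu.
Qed.

Variable s : nat.
Hypothesis s24 : 24 %| s.

(** The position [m] lies over [u] in the cover. The shift [s] is a deck translation followed along
    a whole path; it moves the first vertex to the wedge at 144, where the finite search takes
    place. *)
Definition strip_lift m u := [/\ u < 24 * q + 2,
  ~~ pole q u & strip_index u + 144 = m + s %[mod 24 * q]].

Lemma lift_mod m u : strip_lift m u -> strip_index u %% 24 = m %% 24.
Proof.
case=> _ _ /(congr1 (fun x => x %% 24)); rewrite !modn_dvdm ?dvdn_mulr //.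
have /dvdnP[k ->] := s24.
by rewrite addnC (_ : 144 = 6 * 24) // modnMDl addnC modnMDl.
Qed.

Lemma lift_step m u v : strip_lift m u -> ~~ pole q v -> gadj u v -> 48 <= m ->
  exists m', [/\ m' \in strip_next m, strip_lift m' v & m' <= m + 21 /\ m <= m' + 21].
Proof.
move=> lu nv uv m48; have [_ nu E] := lu; have [d dd Ev] := gadj_link nu nv uv.
have c24 : strip_index u %% 24 < 24 by rewrite ltn_mod.
have db := diffs_bounds c24 dd.
exists (m + d - 48); split; last by move: db m48; clear; lia.
  by rewrite /strip_next diff_tableE ?ltn_mod // -(lift_mod lu); apply: map_f.
split=> //; first by move: uv; rewrite gadj_sym; apply: gadj_lt.
have := eq_modD E Ev; rewrite /= => EE; apply/eqP;
  rewrite -(eqn_modDr (strip_index u + 48)).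
rewrite (_ : strip_index v + 144 + (strip_index u + 48) = strip_index u + 144 +
  (strip_index v + 48)); last by clear; lia.
rewrite EE; apply/eqP; congr (_ %% _); case/andP: db => d27 _; move: m48 d27; clear; lia.
Qed.

(** A step moves at most 21 positions, so 84 allows for four steps. Then [m' + 48] and [m + d]
    differ by at most 105, less than [24 * q], and their congruence is an equality. *)
Lemma lift_adj m m' u v : strip_lift m u -> strip_lift m' v -> gadj u v ->
  m' <= m + 84 -> m <= m' + 84 -> strip_adj m m'.
Proof.
move=> lu lv uv h1 h2; have [[_ nu Eu] [_ nv Ev]] := (lu, lv).
have [d dd E] := gadj_link nu nv uv;
  have c24 : strip_index u %% 24 < 24 by rewrite ltn_mod.
have db := diffs_bounds c24 dd.
have {}E : m' + 48 = m + d %[mod 24 * q].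
  apply/eqP; rewrite -(eqn_modDr (s + strip_index u + 144 + strip_index v)).
  rewrite (_ : m' + 48 + (s + strip_index u + 144 + strip_index v) = m' + s +
    (strip_index u + 144 + (strip_index v + 48))); last first.
    by clear; lia.
  apply/eqP; rewrite -modnDml -Ev modnDml.
  have := eq_modD (erefl ((strip_index v + 144) %% (24 * q))) (eq_modD Eu E).
  by move=> ->; congr (_ %% _); clear; lia.
suff : m' + 48 = m + d.
  rewrite /strip_adj => ->; rewrite addKn diff_tableE ?ltn_mod // -(lift_mod lu) //.
apply/eqP; move/eqP: E; case: (leqP (m' + 48) (m + d)) => le.
  rewrite eq_sym eqn_mod_dvd // => /dvdnP[[|k] kE]; first by move: kE le; clear; lia.
  by exfalso; move: kE q7 h1 h2 db; clear; nia.
rewrite eqn_mod_dvd ?(ltnW le) // => /dvdnP[[|k] kE]; first by move: kE le; clear; lia.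
by exfalso; move: kE q7 h1 h2 db; clear; nia.
Qed.

Lemma idx_lt u : u < 24 * q + 2 -> ~~ pole q u -> strip_index u < 24 * q.
Proof. by rewrite /pole /strip_index; case: ifP; lia. Qed.

Lemma lift_inj m u v : strip_lift m u -> strip_lift m v -> u = v.
Proof.
move=> [un nu Eu] [vn nv Ev]; have : strip_index u = strip_index v %[mod 24 * q].
  by apply/eqP; rewrite -(eqn_modDr 144); apply/eqP; rewrite Eu Ev.
rewrite !modn_small ?idx_lt //; move: nu nv; rewrite /pole /strip_index; clear.
by do !case: ifP; lia.
Qed.

Lemma lift_neq m m' u v : strip_lift m u -> strip_lift m' v -> u != v -> m != m'.
Proof. by move=> lu lv; apply: contra => /eqP mm; apply/eqP; apply: (lift_inj lu);
  rewrite mm. Qed.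

End Lift.

Definition theta5 (T : eqType) (e : rel T) x0 x1 x2 x3 x4 : bool :=
  [&& uniq [:: x0; x1; x2; x3; x4], e x0 x1, e x1 x2, e x2 x3, e x3 x4,
    e x4 x0 & e x0 x2].

Lemma theta5_flip (T : eqType) (e : rel T) x0 x1 x2 x3 x4 : symmetric e ->
  theta5 e x0 x1 x2 x3 x4 -> theta5 e x2 x1 x0 x4 x3.
Proof.
move=> es /and5P[U e01 e12 e23 /and3P[e34 e40 e02]].
rewrite /theta5 es e12 es e01 es e40 es e34 es e23 es e02 !andbT.
by rewrite -(rev_uniq [:: x0; x1; x2; x3; x4]) in U; move: U;
  rewrite /rev /= !inE !negb_or;
  move: (eq_sym x0) (eq_sym x1) (eq_sym x2) (eq_sym x3) => E0 E1 E2 E3;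
  rewrite ?(E0 x1) ?(E0 x2) ?(E0 x3) ?(E0 x4) ?(E1 x2) ?(E1 x3) ?(E1 x4) ?(E2 x3) ?(E2
    x4) ?(E3 x4);
  do !case: (_ == _).
Qed.

Section Large.
Variable q : nat.
Hypothesis q7 : 6 < q.
Let q1 : 1 < q. Proof. exact: ltn_trans q7. Qed.
Notation adj := (gadj q).
Notation pole := (pole q).

Lemma lift_start u : u < 24 * q + 2 -> ~~ pole u ->
  exists s c, [/\ c < 24, 24 %| s & strip_lift q s (144 + c) u].
Proof.
move=> un nu; exists (24 * (strip_index u %/ 24)), (strip_index u %% 24);
  rewrite ltn_mod dvdn_mulr //.
split=> //; split=> //; congr (_ %% _); rewrite {1}(divn_eq (strip_index u) 24).
by rewrite mulnC -addnA addnC [_ %% _ + _]addnC.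
Qed.

(** As a Theta_5 has diameter two, it can contain at most one pole. *)
Lemma poles_far u v : pole u -> pole v -> u != v -> ~~ adj u v /\ forall w, adj w u ->
  ~~ adj w v.
Proof.
move=> pu pv nuv; split; first by apply/negP => /(gadj_pole q7 pu); rewrite pv.
move=> w; rewrite gadj_sym => /(gadj_pole q7 pu)/andP[_ wu].
apply/negP; rewrite gadj_sym => /(gadj_pole q7 pv)/andP[_ wv].
have : near_pole u (strip_index w %% 24) && near_pole v (strip_index w %% 24) by rewrite
  wu.
have S24 : (24 * q + 1 == 24) = false by apply/eqP; lia.
move: pu pv nuv; rewrite /pole /near_pole => /orP[]/eqP-> /orP[]/eqP->;
  rewrite ?eqxx ?S24 // => _ /andP[].
  by rewrite /poleN !inE => /or3P[]/eqP ->.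
by move=> h; rewrite /poleN !inE => /or3P[]/eqP H; move: h; rewrite H.
Qed.

Lemma lift_path x0 x2 x3 x4 : ~~ pole x0 -> ~~ pole x2 -> ~~ pole x3 -> ~~ pole x4 ->
  uniq [:: x0; x2; x3; x4] -> adj x0 x2 -> adj x2 x3 -> adj x3 x4 ->
  exists s m0 m2 m3 m4, [/\ 24 %| s,
    [/\ strip_lift q s m0 x0, strip_lift q s m2 x2,
      strip_lift q s m3 x3 & strip_lift q s m4 x4],
    [/\ 144 <= m0, m0 <= m2 + 21, m2 <= m0 + 21, m2 <= m3 + 21 & m3 <= m2 + 21] /\
    (m3 <= m4 + 21 /\ m4 <= m3 + 21), uniq [:: m0; m2; m3; m4] & strip_check m0 m2 m3 m4].
Proof.
move=> n0 n2 n3 n4 U a02 a23 a34.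
have [s [c [c24 s24 l0]]] := lift_start (gadj_lt q7 a02) n0.
have [|m2 [h2 l2 [b2 b2']]] := lift_step q7 s24 l0 n2 a02;
  first by rewrite -[48]/(48 + 0) leq_add.
have [|m3 [h3 l3 [b3 b3']]] := lift_step q7 s24 l2 n3 a23; first by move: b2'; clear; lia.
have [|m4 [h4 l4 [b4 b4']]] := lift_step q7 s24 l3 n4 a34; first by move: b2' b3';
  clear; lia.
exists s, (144 + c), m2, m3, m4; split=> //.
- move: U; rewrite /= !inE !negb_or => /and4P[/and3P[u1 u2 u3] /andP[u4 u5] u6 _].
  rewrite (lift_neq q7 s24 l0 l2 u1) (lift_neq q7 s24 l0 l3 u2) (lift_neq q7 s24 l0 l4
    u3).
  by rewrite (lift_neq q7 s24 l2 l3 u4) (lift_neq q7 s24 l2 l4 u5) (lift_neq q7 s24 l3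
    l4 u6).
exact: strip_checkT c24 h2 h3 h4.
Qed.

Lemma near_pole_check (u : nat) x0 x2 x3 x4 : strip_check x0 x2 x3 x4 -> uniq [:: x0;
  x2; x3; x4] ->
  (near_pole u (x0 %% 24) && near_pole u (x2 %% 24) ->
    ~~ strip_adj x4 x0 && ~~ near_pole u (x4 %% 24)) /\
  (near_pole u (x2 %% 24) && near_pole u (x4 %% 24) -> ~~ strip_adj x0 x3).
Proof.
move=> /andP[_ /and3P[/andP[h1 h2] /andP[h3 h4] _]] U.
rewrite U /= in h1 h2 h3 h4; rewrite /near_pole; case: (u == 24); split; exact: implyP.
Qed.

Lemma theta5_nopole x0 x1 x2 x3 x4 : theta5 adj x0 x1 x2 x3 x4 ->
  ~~ [|| pole x0, pole x2, pole x3 | pole x4] -> pole x1.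
Proof.
move=> /and5P[U a01 a12 a23 /and3P[a34 a40 a02]].
move=> /norP[n0 /norP[n2 /norP[n3 n4]]].
apply: contraT => n1.
have U' : uniq [:: x0; x2; x3; x4].
  move: U; rewrite /= !inE !negb_or => /and5P[/and4P[_ -> -> ->] _ /andP[-> ->] -> _] //.
have [s [m0 [m2 [m3 [m4 [s24 [l0 l2 l3 l4] [[b0 b1 b2 b3 b4] [b5 b6]] Um ck]]]]]] :=
  lift_path n0 n2 n3 n4 U' a02 a23 a34.
have [|m1 [h1 l1 [c1 c2]]] := lift_step q7 s24 l0 n1 a01; first by apply: leq_trans b0.
have s40 : strip_adj m4 m0 by apply: (lift_adj q7 s24 l4 l0 a40);
  move: b1 b2 b3 b4 b5 b6; clear; lia.
have s12 : strip_adj m1 m2 by apply: (lift_adj q7 s24 l1 l2 a12); move: b1 b2 c1 c2;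
  clear; lia.
case/andP: ck => /implyP; rewrite Um s40 => /(_ isT)/allP/(_ _ h1)/implyP H.
suff /H : uniq [:: m0; m1; m2; m3; m4] by rewrite s12.
move: U Um; rewrite /= !inE !negb_or => /and5P[/and4P[v1 _ _ _] /and3P[v2 v3 v4] _ _ _].
move=> /and4P[/and3P[-> -> ->] /andP[-> ->] -> _]; rewrite !andbT.
rewrite (lift_neq q7 s24 l0 l1 v1) (lift_neq q7 s24 l1 l2 v2).
by rewrite (lift_neq q7 s24 l1 l3 v3) (lift_neq q7 s24 l1 l4 v4).
Qed.

(** The path without the pole is [x1 x2 x3 x4], [x0 x2 x3 x4] or [x1 x2 x0 x4] respectively. The
    remaining positions of the pole reduce to these by [theta5_flip], which exchanges [x0] with [x2]
    and [x3] with [x4]. *)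
Lemma theta5_pole013 x0 x1 x2 x3 x4 : theta5 adj x0 x1 x2 x3 x4 ->
  [|| pole x0, pole x1 | pole x3] -> False.
Proof.
move=> th; have /and5P[U a01 a12 a23 /and3P[a34 a40 a02]] := th.
have a10 : adj x1 x0 by rewrite gadj_sym.
have a32 : adj x3 x2 by rewrite gadj_sym.
have a04 : adj x0 x4 by rewrite gadj_sym.
have a20 : adj x2 x0 by rewrite gadj_sym.
have a21 : adj x2 x1 by rewrite gadj_sym.
have a43 : adj x4 x3 by rewrite gadj_sym.
move: U; rewrite /= !inE !negb_or =>
  /and5P[/and4P[u01 u02 u03 u04] /and3P[u12 u13 u14] /andP[u23 u24] u34 _].
have at2 u v w : pole u -> u != v -> adj w u -> adj w v -> ~~ pole v.
  move=> pu nuv wu wv; apply/negP => pv; have [_ far] := poles_far pu pv nuv.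
  by move: (far _ wu); rewrite wv.
have at1 u v : pole u -> adj u v ->
  ~~ pole v && near_pole u (strip_index v %% 24) by move=> pu /(gadj_pole q7 pu).
case/or3P => p.
- have /andP[n1 p1] := at1 _ _ p a01; have /andP[n2 p2] := at1 _ _ p a02;
  have /andP[n4 p4] := at1 _ _ p a04.
  have n3 : ~~ pole x3 by apply: (at2 _ _ _ p u03 a40 a43).
  have U' : uniq [:: x1; x2; x3; x4] by rewrite /= !inE !negb_or u12 u13 u14 u23 u24 u34.
  have [s [m0 [m2 [m3 [m4 [s24 [l0 l2 l3 l4] _ Um ck]]]]]] := lift_path n1 n2 n3 n4 U'
    a12 a23 a34.
  have [key _] := near_pole_check x0 ck Um.
  rewrite (lift_mod s24 l0) in p1; rewrite (lift_mod s24 l2) in p2;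
    rewrite (lift_mod s24 l4) in p4.
  by move: key; rewrite p1 p2 p4 andbF => /(_ isT).
- have /andP[n0 p0] := at1 _ _ p a10; have /andP[n2 p2] := at1 _ _ p a12.
  have n3 : ~~ pole x3 by apply: (at2 _ _ _ p u13 a21 a23).
  have n4 : ~~ pole x4 by apply: (at2 _ _ _ p u14 a01 a04).
  have U' : uniq [:: x0; x2; x3; x4] by rewrite /= !inE !negb_or u02 u03 u04 u23 u24 u34.
  have [s [m0 [m2 [m3 [m4 [s24 [l0 l2 l3 l4] [[b0 b1 b2 b3 b4] [b5 b6]] Um ck]]]]]] :=
    lift_path n0 n2 n3 n4 U' a02 a23 a34.
  have s40 : strip_adj m4 m0 by apply: (lift_adj q7 s24 l4 l0 a40);
    move: b1 b2 b3 b4 b5 b6; clear; lia.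
  have [key _] := near_pole_check x1 ck Um.
  rewrite (lift_mod s24 l0) in p0; rewrite (lift_mod s24 l2) in p2.
  by move: key; rewrite p0 p2 s40 => /(_ isT).
have /andP[n2 p2] := at1 _ _ p a32; have /andP[n4 p4] := at1 _ _ p a34.
have n0 : ~~ pole x0 by apply: (at2 _ _ _ p _ a43 a40); rewrite eq_sym.
have n1 : ~~ pole x1 by apply: (at2 _ _ _ p _ a23 a21); rewrite eq_sym.
have U' : uniq [:: x1; x2; x0; x4].
  by rewrite /= !inE !negb_or u12 u14 eq_sym u01 eq_sym u02 u04 u24.
have [s [m0 [m2 [m3 [m4 [s24 [l0 l2 l3 l4] [[b0 b1 b2 b3 b4] [b5 b6]] Um ck]]]]]] :=
  lift_path n1 n2 n0 n4 U' a12 a20 a04.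
have s10 : strip_adj m0 m3 by apply: (lift_adj q7 s24 l0 l3 a10); move: b1 b2 b3 b4;
  clear; lia.
have [_ key] := near_pole_check x3 ck Um.
rewrite (lift_mod s24 l2) in p2; rewrite (lift_mod s24 l4) in p4.
by move: key; rewrite p2 p4 s10 => /(_ isT).
Qed.

Lemma theta5_free_large x0 x1 x2 x3 x4 : ~~ theta5 adj x0 x1 x2 x3 x4.
Proof.
apply/negP => th; have th' := theta5_flip (gadj_sym q) th.
have : [|| pole x0, pole x1 | pole x3] || [|| pole x2, pole x1 | pole x4].
  have := theta5_nopole th.
  by case: (pole x0); case: (pole x2); case: (pole x3); case: (pole x4);
    rewrite ?orbT //= => /(_ isT) ->.
by case/orP; [apply: (theta5_pole013 th) | apply: (theta5_pole013 th')].
Qed.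

End Large.

(** A band of two wedges is too short for [lift_adj], so the 50 vertices are searched directly. *)
Lemma theta5_free_two x0 x1 x2 x3 x4 : ~~ theta5 (gadj 2) x0 x1 x2 x3 x4.
Proof.
pose g := gadget 2.
pose tab := [seq [seq e.2 | e <- g & e.1 == u] ++ [seq e.1 | e <- g & e.2 == u] | u <-
  iota 0 50].
have tabE u v : gadj 2 u v -> u < 50 /\ v \in nth [::] tab u.
  move=> uv; have u50 : u < 50.
    case/orP: uv => /(sweep_born_lt (sweep_gadget (ltnSn 1))) /= /andP[]; last by [].
    by apply: ltn_trans.
  split=> //; rewrite (nth_map 0) ?size_iota // nth_iota // add0n mem_cat.
  case/orP: uv => uv; apply/orP; [left|right]; apply/mapP.
    by exists (u, v) => //; rewrite mem_filter eqxx.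
  by exists (v, u) => //; rewrite mem_filter eqxx.
have ck : let t := tab in all (fun x0 => all (fun x2 => all (fun x1 =>
  (x1 == x2) || (x1 \notin nth [::] t x2) ||
    all (fun x3 => all (fun x4 => (x0 \in nth [::] t x4) ==> ~~ uniq [:: x0; x1; x2; x3;
      x4])
      (nth [::] t x3)) (nth [::] t x2)) (nth [::] t x0)) (nth [::] t x0)) (iota 0 50).
  by vm_compute.
apply/negP => /and5P[U a01 a12 a23 /and3P[a34 a40 a02]].
have [u0 h01] := tabE _ _ a01; have [_ h02] := tabE _ _ a02; have [_ h23] := tabE _ _ a23.
have [_ h34] := tabE _ _ a34; have [_ h40] := tabE _ _ a40.
have [_ h21] : x2 < 50 /\ x1 \in nth [::] tab x2 by apply: tabE; rewrite gadj_sym.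
have /allP/(_ x0) := ck; rewrite mem_iota => /(_ u0)/allP/(_ _ h02)/allP/(_ _ h01).
rewrite h21 orbF => /orP[/eqP E|/allP/(_ _ h23)/allP/(_ _ h34)].
  by move: U; rewrite E /= !inE eqxx andbF.
by rewrite h40 U.
Qed.

End Gadget.

(** * The extremal graphs and the theorem *)

Lemma chord5 (i j : 'I_5) : i != j -> [set i; j] \notin cycle_edges 5 ->
  j = ordS (ordS i) \/ i = ordS (ordS j).
Proof.
move=> nij nc; have ni : j != ordS i.
  by apply: contraNneq nc => ->; apply/imsetP; exists i.
have nj : i != ordS j.
  by apply: contraNneq nc => ->; rewrite setUC; apply/imsetP; exists j.
move: nij ni nj {nc}; rewrite -!val_eqE; case: i => -[|[|[|[|[|//]]]]] ? /=;
  case: j => -[|[|[|[|[|//]]]]] ? //= _ _ _; by [left; apply: val_inj | right;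
    apply: val_inj].
Qed.

Lemma no_theta5_free (V : finType) (G : sgraph V) :
  no_theta5 (edges G) -> family_free (Theta 5) G.
Proof.
move=> nt m H [m5]; subst m; move=> [i [j [nij nc EH]]] [f [finj fE]].
have cyc k : [set f k; f (ordS k)] \in edges G.
  rewrite -(imset_set1 f k) -(imset_set1 f (ordS k)) -imsetU; apply: fE.
  by rewrite EH; apply/setU1P; right; apply/imsetP; exists k.
have chord : [set f i; f j] \in edges G.
  by rewrite -(imset_set1 f i) -(imset_set1 f j) -imsetU; apply: fE; rewrite EH setU11.
have main k : [set f k; f (ordS (ordS k))] \in edges G -> False.
  have S5 : ordS (ordS (ordS (ordS (ordS k)))) = k.
    by case: k => -[|[|[|[|[|//]]]]] ?; apply: val_inj.
  have c4 := cyc (ordS (ordS (ordS (ordS k)))); rewrite S5 in c4.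
  apply: (nt _ _ _ _ _ _ (cyc k) (cyc _) (cyc _) (cyc _) c4).
  rewrite /= !inE !(inj_eq finj) -!val_eqE.
  by case: k {S5 c4} => -[|[|[|[|[|//]]]]] ?.
case: (chord5 nij nc) => E; first by apply: (main i); rewrite -E.
by apply: (main j); rewrite -E setUC.
Qed.

Section GadgetGraph.
Variable q : nat.
Hypothesis q1 : (1 < q)%N.
Local Notation n := (24 * q + 2)%N.

Let arcs := [set p : 'I_n * 'I_n | (p.1 : nat, p.2 : nat) \in gadget q].
Let pair_of (p : 'I_n * 'I_n) := [set p.1; p.2].

Lemma arc_lt p : p \in arcs -> (p.1 < p.2)%N.
Proof. by rewrite inE => /(sweep_born_lt (sweep_gadget q1)) /= /andP[]. Qed.

Lemma gadget_edgesP : [forall e in pair_of @: arcs, #|e| == 2%N].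
Proof.
apply/forall_inP => _ /imsetP[p /arc_lt lt ->].
by rewrite cards2 -val_eqE neq_ltn lt.
Qed.

Definition gadget_graph := SGraph gadget_edgesP.

Lemma gadget_graph_adj u v : [set u; v] \in edges gadget_graph -> gadj q u v.
Proof.
move=> /imsetP[[a b] + /eqP /doubleton_eqP]; rewrite inE /gadj /= => ab.
by case=> -[-> ->]; rewrite ab ?orbT.
Qed.

Lemma card_gadget_graph : #|edges gadget_graph| = (60 * q)%N.
Proof.
rewrite card_in_imset => [|[a b] [c d] /arc_lt ab /arc_lt cd /eqP/doubleton_eqP];
  last first.
  by case=> -[/= ac bd]; [rewrite ac bd | move: ab cd;
    rewrite /= ac bd ltnNge => /negbTE E /ltnW; rewrite E].
rewrite -(size_gadget q1) cardE -(size_map (fun p : 'I_n * 'I_n =>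
  (p.1 : nat, p.2 : nat))).
apply: perm_size; apply: uniq_perm.
- by rewrite map_inj_uniq ?enum_uniq // => -[a b] [c d] /= [/val_inj -> /val_inj ->].
- exact: sweep_uniq (sweep_gadget q1).
move=> [u v]; apply/mapP/idP => [[p]|uv]; first by rewrite mem_enum inE => ? ->.
have /= /andP[lt vn] := sweep_born_lt (sweep_gadget q1) uv.
by exists (Ordinal (ltn_trans lt vn), Ordinal vn); rewrite // mem_enum inE.
Qed.

Lemma planar_gadget_graph (R : realType) : planar R gadget_graph.
Proof.
apply: (sweep_planar R (sweep_gadget q1)) => _ /imsetP[p + ->]; rewrite inE => pg.
by exists p.1, p.2.
Qed.

Lemma gadget_graph_free : q = 2%N \/ (6 < q)%N -> family_free (Theta 5) gadget_graph.
Proof.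
move=> q27; apply: no_theta5_free => x0 x1 x2 x3 x4 U e01 e12 e23 e34 e40 e02.
have no_theta (y0 y1 y2 y3 y4 : nat) : ~~ theta5 (gadj q) y0 y1 y2 y3 y4.
  by case: q27 => [->|q7]; [exact: theta5_free_two | exact: theta5_free_large].
have /negP := no_theta x0 x1 x2 x3 x4; apply; rewrite /theta5 !gadget_graph_adj // !andbT.
by rewrite -(map_inj_uniq val_inj) in U.
Qed.

End GadgetGraph.

Theorem theorem2p2 (R : realType) (n : nat) (hn : (5 <= n)%N) :
  ((exP R n (Theta 5))%:R <= 5%:R * (n%:R - 2%:R) / 2%:R :> rat) /\
  (n = 50 %[mod 120] ->
   (exP R n (Theta 5))%:R = 5%:R * (n%:R - 2%:R) / 2%:R :> rat).
Proof.
have bound : (2 * exP R n (Theta 5) + 10 <= 5 * n)%N.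
  have : (exP R n (Theta 5) <= (5 * n - 10)./2)%N.
    apply/bigmax_leqP => G /asboolP[pl fr]; have := @planar_theta5_free_bound R _ G.
    by rewrite card_ord => /(_ hn pl fr); lia.
  by lia.
have scale (a : nat) :
    (a%:R <= 5%:R * (n%:R - 2%:R) / 2%:R :> rat) = (2 * a + 10 <= 5 * n)%N.
  rewrite ler_pdivlMr // mulrBr lerBrDr -natrM -!natrM -natrD ler_nat.
  by rewrite mulnC.
split; first by rewrite scale.
move=> n50; apply: le_anti; rewrite scale bound /=.
(* From [n = 120 k + 50] one gets [n - 2 = 24 (2 + 5 k)]. *)
have [k nk] : exists k, n = (24 * (2 + 5 * k) + 2)%N.
  by exists (n %/ 120)%N; have := divn_eq n 120; rewrite n50; lia.
subst n; set q := (2 + 5 * k)%N in scale bound *; have q1 : (1 < q)%N by [].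
have q27 : q = 2%N \/ (6 < q)%N by rewrite /q; case: k {q1 scale bound hn n50 q};
  [left|right; lia].
have : (60 * q <= exP R (24 * q + 2) (Theta 5))%N.
  rewrite -(card_gadget_graph q1); apply: leq_bigmax_cond.
  by apply/asboolP; split; [apply: planar_gadget_graph | apply: gadget_graph_free].
rewrite -(ler_nat rat); apply: le_trans.
rewrite ler_pdivrMr // natrD addrK -!natrM ler_nat; lia.
Qed.
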